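(* Let $\Sigma$ be a finite alphabet with at least two letters. Let $L = L(\mathcal{A})\subseteq \Sigma^\omega$ be a regular $\omega$-language accepted by a Büchi or Muller automaton $\mathcal{A}$. Then one can construct (i.e. there is an algorithm which, given $\mathcal{A}$, outputs) Büchi automata $\mathcal{B}$ and $\mathcal{C}$ over $\Sigma$ such that $L(\mathcal{B})\subseteq \Sigma^\omega$ is open, $L(\mathcal{C})\subseteq \Sigma^\omega$ is a countable union of closed sets with empty interior, and $L(\mathcal{A}) \,\Delta\, L(\mathcal{B})\subseteq L(\mathcal{C})$.
   Context: $\Sigma^\omega$ denotes the set of infinite words $a_1a_2a_3\ldots$ over the finite alphabet $\Sigma$; it is equipped with the product topology of the discrete topology on $\Sigma$ (the Cantor topology). $A\,\Delta\,B$ denotes symmetric difference. A finite state machine is a quadruple $(K,\Sigma,\delta,q_0)$ with $K$ a finite set of states, $\Sigma$ a finite input alphabet, $q_0\in K$ the initial state and $\delta: K\times\Sigma\to 2^K$. A run on $\sigma=a_1a_2\ldots\in\Sigma^\omega$ is a sequence of states $r=q_1q_2\ldots$ whose first term $q_1$ is the initial state and with $q_{i+1}\in\delta(q_i,a_i)$ for all $i\ge 1$. $\mathrm{In}(r)$ is the set of states occurring infinitely often in $r$. A Büchi automaton is a tuple $(K,\Sigma,\delta,q_0,F)$ with $(K,\Sigma,\delta,q_0)$ a finite state machine and $F\subseteq K$; it accepts $\sigma$ iff there is a run $r$ on $\sigma$ with $\mathrm{In}(r)\cap F\ne\emptyset$. A Muller automaton is a tuple $(K,\Sigma,\delta,q_0,\mathcal{F})$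 with $(K,\Sigma,\delta,q_0)$ a finite state machine and $\mathcal{F}\subseteq 2^K$; it accepts $\sigma$ iff there is a run $r$ on $\sigma$ with $\mathrm{In}(r)\in\mathcal{F}$. $L(\mathcal{A})$ is the set of all $\sigma\in\Sigma^\omega$ accepted by $\mathcal{A}$. An $\omega$-language is regular iff it is accepted by some Büchi automaton (equivalently, by some Muller automaton). *)

(* Defs.v *)
From mathcomp Require Import all_boot.
From mathcomp Require Import all_classical all_reals topology.

Set Implicit Arguments.
Unset Strict Implicit.
Unset Printing Implicit Defensive.

Local Open Scope classical_set_scope.

(* Infinite words are indexed from 0. *)
Notation omega_words Sigma :=
  (prod_topology (fun _ : nat => discrete_topology Sigma)).

Record fsm (Sigma : finType) := Fsm {
  state : finType;
  trans : state -> Sigma -> {set state};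
  init : state }.

Record buchi (Sigma : finType) := Buchi {
  buchi_fsm : fsm Sigma;
  buchi_acc : {set state buchi_fsm} }.

Record muller (Sigma : finType) := Muller {
  muller_fsm : fsm Sigma;
  muller_acc : {set {set state muller_fsm}} }.

Definition is_run (Sigma : finType) (M : fsm Sigma)
    (w : omega_words Sigma) (r : nat -> state M) : Prop :=
  r 0 = init M /\ forall i, r i.+1 \in trans (r i) (w i).

Definition inf_states (K : finType) (r : nat -> K) : {set K} :=
  [set q | `[< forall n, exists2 m, n <= m & r m = q >]]%SET.

Definition buchi_lang (Sigma : finType) (A : buchi Sigma) :
    set (omega_words Sigma) :=
  [set w | exists2 r : nat -> state (buchi_fsm A),
     is_run w r & inf_states r :&: buchi_acc A != finset.set0].

Definition muller_lang (Sigma : finType) (A : muller Sigma) :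
    set (omega_words Sigma) :=
  [set w | exists2 r : nat -> state (muller_fsm A),
     is_run w r & inf_states r \in muller_acc A].

Definition lang (Sigma : finType) (A : buchi Sigma + muller Sigma) :
    set (omega_words Sigma) :=
  match A with inl B => buchi_lang B | inr M => muller_lang M end.

(* The general recursive functions of Kleene, in their total form: minimization
   is allowed only when a zero exists for all values of the parameters.
   [iteri n h x] is h (n-1) (... (h 1 (h 0 x))). *)
Inductive recursive : forall n : nat, (n.-tuple nat -> nat) -> Prop :=
| recursive_zero : recursive (fun _ : 0.-tuple nat => 0)
| recursive_succ : recursive (fun v : 1.-tuple nat => (thead v).+1)
| recursive_proj n (i : 'I_n) : recursive (fun v : n.-tuple nat => tnth v i)
| recursive_comp m n (g : m.-tuple nat -> nat)
    (h : 'I_m -> n.-tuple nat -> nat) :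
    recursive g -> (forall i, recursive (h i)) ->
    recursive (fun v => g [tuple h i v | i < m])
| recursive_prim n (f : n.-tuple nat -> nat) (g : n.+2.-tuple nat -> nat) :
    recursive f -> recursive g ->
    recursive (fun v : n.+1.-tuple nat =>
      iteri (thead v) (fun k x => g [tuple of [:: k, x & behead v]])
        (f [tuple of behead v]))
| recursive_min n (g : n.+1.-tuple nat -> nat) (f : n.-tuple nat -> nat) :
    recursive g ->
    (forall v, g [tuple of f v :: v] = 0) ->
    (forall v k, k < f v -> g [tuple of k :: v] <> 0) ->
    recursive f.

Definition computable (f : nat -> nat) : Prop :=
  recursive (fun v : 1.-tuple nat => f (thead v)).

(* Automata are presented to algorithms as finite lists of numbers, states being
   numbered by [enum_rank] and letters in the order of [enum Sigma]; the number
   of states and the number of letters are listed first. Only these lists are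
   turned into numbers by [pickle], as the [pickle] of an abstract finite type
   is arbitrary. *)
Definition set_data (K : finType) (S : {set K}) : seq nat :=
  [seq nat_of_ord (enum_rank q) | q <- enum S].

Definition fsm_data (Sigma : finType) (M : fsm Sigma) :
    nat * nat * nat * seq (seq (seq nat)) :=
  (#|state M|, #|Sigma|, nat_of_ord (enum_rank (init M)),
   [seq [seq set_data (trans q a) | a <- enum Sigma] | q <- enum (state M)]).

Definition buchi_data (Sigma : finType) (A : buchi Sigma) :
    nat * nat * nat * seq (seq (seq nat)) * seq nat :=
  (fsm_data (buchi_fsm A), set_data (buchi_acc A)).

Definition muller_data (Sigma : finType) (A : muller Sigma) :
    nat * nat * nat * seq (seq (seq nat)) * seq (seq nat) :=
  (fsm_data (muller_fsm A), [seq set_data X | X <- enum (muller_acc A)]).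

Definition input_code (Sigma : finType) (A : buchi Sigma + muller Sigma) : nat :=
  match A with
  | inl B => pickle (0, buchi_data B)
  | inr M => pickle (1, muller_data M)
  end.

Definition output_code (Sigma : finType) (B C : buchi Sigma) : nat :=
  pickle (buchi_data B, buchi_data C).

(* Main.v *)
(* A single word z, computable from the numbers of states and letters alone,
   decides acceptance of almost all inputs. The profile of a word w is the set
   of the triples (p, S, q) such that w leads from p to q through the states of
   S; profiles form a finite monoid. Take for z a power, with idempotent profile
   e, of a word that contains all words of length N, the number of profiles, and
   hence factors of all profiles. Then e lies in the minimal ideal, so (e x e)^n
   = e with n > 0 for the profile x of any word. If z occurs infinitely often in
   sigma, it follows that sigma is accepted iff, at some occurrence of z, a run
   can be in a state q such that z leads from q to some p and from p back to p
   through exactly the states of an accepting set.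
   B accepts the sigma for which this happens at some occurrence of z, which
   depends on a finite prefix. C accepts the sigma in which, from some position
   n on, z is never one of the consecutive blocks of length |z|; for fixed n this
   is a closed condition, and any prefix can be extended so as to violate it.
   Muller and Buechi acceptance are both conditions on In(r). *)
From HB Require Import structures.
Require Import Defs.
From mathcomp Require Import all_boot.
From mathcomp Require Import all_classical all_reals topology.

Set Implicit Arguments.
Unset Strict Implicit.
Unset Printing Implicit Defensive.

Local Open Scope classical_set_scope.

(** * Primitive recursion on lists of arguments *)

(* The arguments are the entries of a list of any fixed length, an absent one
   being 0 by the convention of [nth]. *)
Variant primrec (f : seq nat -> nat) : Prop :=
  Primrec of forall n, recursive (fun v : n.-tuple nat => f v).

Lemma recursive_subst m n (g : m.-tuple nat -> nat)
    (h : n.-tuple nat -> m.-tuple nat) :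
  recursive g -> (forall i, recursive (fun v => tnth (h v) i)) ->
  recursive (fun v => g (h v)).
Proof.
move=> gR hR.
have -> : (fun v => g (h v)) = (fun v => g [tuple tnth (h v) i | i < m]).
  by apply: funext => v; congr g; apply: eq_from_tnth => i; rewrite tnth_mktuple.
exact: (recursive_comp gR hR).
Qed.

Lemma primrec_const c : primrec (fun=> c).
Proof.
constructor=> n; elim: c => [|c IHc].
  by apply: (@recursive_subst 0 n _ (fun=> [tuple]) recursive_zero) => -[].
apply: (@recursive_subst 1 n _ (fun=> [tuple c]) recursive_succ) => i.
by rewrite (ord1 i); apply: IHc.
Qed.

Lemma primrec_nth i : primrec (fun v => nth 0 v i).
Proof.
constructor=> n; have [lt_in|le_ni] := ltnP i n.
  have -> : (fun v : n.-tuple nat => nth 0 v i) = (fun v => tnth v (Ordinal lt_in)).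
    by apply: funext => v; rewrite (tnth_nth 0).
  exact: recursive_proj.
have -> : (fun v : n.-tuple nat => nth 0 v i) = fun=> 0.
  by apply: funext => v; rewrite nth_default ?size_tuple.
by case: (primrec_const 0).
Qed.

(** A bound variable is pushed onto the front of the argument list, so under a binder the outer
    parameters are reached through [behead]. *)
Lemma primrec_behead f : primrec f -> primrec (fun v => f (behead v)).
Proof.
move=> [fP]; constructor=> -[|n].
  have -> : (fun v : 0.-tuple nat => f (behead v)) = fun=> f [::].
    by apply: funext => v; rewrite tuple0.
  by case: (primrec_const (f [::])).
apply: (@recursive_subst n n.+1 (fun u => f u)
  (fun v => [tuple of behead v])) => // i.
under eq_fun do rewrite (tnth_nth 0) nth_behead.
by case: (primrec_nth i.+1).
Qed.

(** In the body of an iteration, counter and accumulator head the list; here one computed value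
    takes their place, as the argument of a function with a single bound variable. *)
Lemma primrec_subst2 f g : primrec f -> primrec g ->
  primrec (fun w => f (g w :: behead (behead w))).
Proof.
move=> [fP] [gP]; constructor=> n.
apply: (@recursive_subst _ n (fun u => f u)
  (fun v => [tuple of g v :: behead (behead v)])) => // i.
under eq_fun do rewrite (tnth_nth 0).
case: (unliftP ord0 i) => [j|] -> /=; last exact: gP.
under eq_fun do rewrite 2!nth_behead.
by case: (primrec_nth j.+2).
Qed.

Lemma primrec_succ f : primrec f -> primrec (fun v => (f v).+1).
Proof.
move=> [fP]; constructor=> n.
apply: (@recursive_subst 1 n _ (fun v => [tuple f v]) recursive_succ) => i.
by rewrite (ord1 i); apply: fP.
Qed.

Lemma primrec_iteri b (g : nat -> nat -> seq nat -> nat) a :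
  primrec b -> primrec (fun w => g (nth 0 w 0) (nth 0 w 1) (behead (behead w))) ->
  primrec a ->
  primrec (fun v => iteri (b v) (fun k x => g k x v) (a v)).
Proof.
move=> [bP] [gP] [aP]; constructor=> n.
have := recursive_prim (aP n) (gP n.+2).
pose h (v : n.-tuple nat) : n.+1.-tuple nat := [tuple of b v :: v].
move=> /(@recursive_subst n.+1 n _ h) R.
have -> : (fun v : n.-tuple nat => iteri (b v) (fun k x => g k x v) (a v)) =
  (fun v => iteri (thead (h v))
    (fun k x => g k x (behead (h v))) (a (behead (h v)))).
  by apply: funext => v; rewrite theadE /=.
apply: R => i; case: (unliftP ord0 i) => [j|] ->; last exact: bP.
under eq_fun do rewrite tnthS.
exact: recursive_proj.
Qed.

Lemma primrec_computable f :
  primrec (fun v => f (nth 0 v 0)) -> computable f.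
Proof.
case=> /(_ 1) fP; rewrite /computable.
move: fP; congr recursive; apply: funext => v.
by case/tupleP: v => x v; rewrite theadE.
Qed.

(* In these functions x stands for the list s such that x = CodeSeq.code s. *)
Definition code_head (x : nat) : nat := logn 2 x.
Definition code_tail (x : nat) : nat := x %/ 2 ^ (code_head x).+1.
Definition code_nth (x i : nat) : nat := code_head (iter i code_tail x).
Definition code_lt (i x : nat) : bool := iter i code_tail x != 0.
Definition code_mem (x j : nat) : bool :=
  has (fun i => code_lt i x && (code_nth x i == j)) (iota 0 x).
Definition code_pair (x y : nat) : nat := CodeSeq.code [:: x; y].

Ltac primrec_base :=
  first
  [ assumption
  | exact: primrec_const
  | exact: primrec_nth
  | match goal with H : primrec ?f |- primrec (fun w => ?f w) => exact: H end
  | match goal with H : primrec ?f |- primrec (fun w => ?f (behead w)) =>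
      exact: (primrec_behead H) end
  | match goal with
    H : primrec ?f |- primrec (fun w => ?f (behead (behead w))) =>
      exact: (primrec_behead (primrec_behead H)) end
  | apply: primrec_succ ].

Ltac primrec_under := cbv beta; repeat under eq_fun do rewrite nth_behead.

Lemma primrec_pred f : primrec f -> primrec (fun v => (f v).-1).
Proof.
move=> fP.
have -> : (fun v => (f v).-1) = (fun v => iteri (f v) (fun k _ => k) 0).
  by apply: funext => v; case: (f v).
by apply: primrec_iteri; primrec_under; primrec_base.
Qed.

Lemma primrec_iter f (F : seq nat -> nat -> nat) g :
  primrec f -> primrec (fun w => F (behead w) (nth 0 w 0)) -> primrec g ->
  primrec (fun v => iter (f v) (F v) (g v)).
Proof.
move=> fP FP gP.
have -> : (fun v => iter (f v) (F v) (g v)) =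
    (fun v => iteri (f v) (fun _ => F v) (g v)).
  by apply: funext => v; elim: (f v) => //= n ->.
apply: primrec_iteri => //.
have -> : (fun w => F (behead (behead w)) (nth 0 w 1)) =
    (fun w => (fun u => F (behead u) (nth 0 u 0)) (behead w)).
  by apply: funext => w /=; rewrite nth_behead.
exact: (primrec_behead FP).
Qed.

Lemma primrec_add f g :
  primrec f -> primrec g -> primrec (fun v => f v + g v).
Proof.
move=> fP gP; have -> : (fun v => f v + g v) =
    (fun v => iter (f v) succn (g v)).
  by apply: funext => v; elim: (f v) => //= n <-.
by apply: primrec_iter; primrec_under; repeat primrec_base.
Qed.

Lemma primrec_sub f g :
  primrec f -> primrec g -> primrec (fun v => f v - g v).
Proof.
move=> fP gP; have -> : (fun v => f v - g v) =
    (fun v => iter (g v) predn (f v)).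
  by apply: funext => v; elim: (g v) => [|n IH]; rewrite ?subn0 //= -IH subnS.
by apply: primrec_iter => //; apply: primrec_pred; primrec_base.
Qed.

Lemma primrec_mul f g :
  primrec f -> primrec g -> primrec (fun v => f v * g v).
Proof.
move=> fP gP; have -> : (fun v => f v * g v) =
    (fun v => iter (f v) (addn (g v)) 0).
  by apply: funext => v; elim: (f v) => //= n <-; rewrite mulSn.
by apply: primrec_iter => //; try apply: primrec_add; primrec_base.
Qed.

Lemma primrec_exp f g :
  primrec f -> primrec g -> primrec (fun v => f v ^ g v).
Proof.
move=> fP gP; have -> : (fun v => f v ^ g v) =
    (fun v => iter (g v) (muln (f v)) 1).
  by apply: funext => v; elim: (g v) => //= n <-; rewrite expnS.
by apply: primrec_iter => //; try apply: primrec_mul; primrec_base.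
Qed.

Lemma primrec_factorial f : primrec f -> primrec (fun v => (f v)`!).
Proof.
move=> fP; have -> : (fun v => (f v)`!) =
    (fun v => iteri (f v) (fun k x => k.+1 * x) 1).
  by apply: funext => v; elim: (f v) => //= n <-; rewrite factS.
by apply: primrec_iteri => //; try apply: primrec_mul; repeat primrec_base.
Qed.

Lemma primrec_leq f g :
  primrec f -> primrec g -> primrec (fun v => f v <= g v : nat).
Proof.
move=> fP gP; have -> : (fun v => f v <= g v : nat) =
    (fun v => 1 - (f v - g v)).
  by apply: funext => v; rewrite /leq; case: (_ - _) => // n; rewrite subSS sub0n.
by do 2![apply: primrec_sub; try primrec_base].
Qed.

Lemma primrec_andb (f g : seq nat -> bool) : primrec (fun v => f v : nat) ->
  primrec (fun v => g v : nat) -> primrec (fun v => f v && g v : nat).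
Proof.
move=> fP gP; under eq_fun do rewrite -mulnb.
exact: primrec_mul.
Qed.

Lemma primrec_negb (f : seq nat -> bool) : primrec (fun v => f v : nat) ->
  primrec (fun v => ~~ f v : nat).
Proof.
move=> fP; have -> : (fun v => ~~ f v : nat) = (fun v => 1 - f v).
  by apply: funext => v; case: (f v).
by apply: primrec_sub => //; primrec_base.
Qed.

Lemma primrec_orb (f g : seq nat -> bool) : primrec (fun v => f v : nat) ->
  primrec (fun v => g v : nat) -> primrec (fun v => f v || g v : nat).
Proof.
move=> fP gP; under eq_fun do rewrite -[_ || _]negbK negb_or.
by apply: primrec_negb; apply: primrec_andb; apply: primrec_negb.
Qed.

Lemma primrec_eqn f g :
  primrec f -> primrec g -> primrec (fun v => f v == g v : nat).
Proof.
move=> fP gP; under eq_fun do rewrite eqn_leq.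
by apply: primrec_andb; apply: primrec_leq.
Qed.

Lemma primrec_if (b : seq nat -> bool) f g : primrec (fun v => b v : nat) ->
  primrec f -> primrec g -> primrec (fun v => if b v then f v else g v).
Proof.
move=> bP fP gP; have -> : (fun v => if b v then f v else g v) =
    (fun v => b v * f v + ~~ b v * g v).
  by apply: funext => v; case: (b v); rewrite mul1n ?mul0n ?addn0.
by apply: primrec_add; apply: primrec_mul => //; apply: primrec_negb.
Qed.

Lemma primrec_eqb (f g : seq nat -> bool) : primrec (fun v => f v : nat) ->
  primrec (fun v => g v : nat) ->
  primrec (fun v => f v == g v :> bool : nat).
Proof.
move=> fP gP; have -> : (fun v => f v == g v :> bool : nat) =
    (fun v => f v == g v :> nat : nat).
  by apply: funext => v; case: (f v); case: (g v).
exact: primrec_eqn.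
Qed.

Ltac primrec_op := cbv beta;
  lazymatch goal with
  | |- primrec (fun v => @?f v + @?g v) => apply: (@primrec_add f g)
  | |- primrec (fun v => @?f v - @?g v) => apply: (@primrec_sub f g)
  | |- primrec (fun v => @?f v * @?g v) => apply: (@primrec_mul f g)
  | |- primrec (fun v => @?f v ^ @?g v) => apply: (@primrec_exp f g)
  | |- primrec (fun v => (@?f v)`!) => apply: (@primrec_factorial f)
  | |- primrec (fun v => nat_of_bool (@?f v <= @?g v)) =>
      apply: (@primrec_leq f g)
  | |- primrec (fun v => nat_of_bool (@?f v == @?g v)) =>
      first [apply: (@primrec_eqn f g) | apply: (@primrec_eqb f g)]
  | |- primrec (fun v => nat_of_bool (@?f v && @?g v)) =>
      apply: (@primrec_andb f g)
  | |- primrec (fun v => nat_of_bool (@?f v || @?g v)) =>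
      apply: (@primrec_orb f g)
  | |- primrec (fun v => nat_of_bool (~~ @?f v)) => apply: (@primrec_negb f)
  | |- _ => primrec_base
  end.

Lemma primrec_has n (P : seq nat -> nat -> bool) : primrec n ->
  primrec (fun w => P (behead w) (nth 0 w 0) : nat) ->
  primrec (fun v => has (P v) (iota 0 (n v)) : nat).
Proof.
move=> nP PP.
have -> : (fun v => has (P v) (iota 0 (n v)) : nat) =
    (fun v => iteri (n v) (fun k x => (0 < P v k + x)) 0).
  apply: funext => v; elim: (n v) => // m IH.
  rewrite -addn1 iotaD has_cat /= orbF addn1 /= -IH.
  by case: (has _ _); case: (P v _).
apply: primrec_iteri; primrec_under; repeat primrec_op.
by apply: (@primrec_subst2 (fun w => P (behead w) (nth 0 w 0))); primrec_base.
Qed.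

Lemma primrec_all n (P : seq nat -> nat -> bool) : primrec n ->
  primrec (fun w => P (behead w) (nth 0 w 0) : nat) ->
  primrec (fun v => all (P v) (iota 0 (n v)) : nat).
Proof.
move=> nP PP; under eq_fun do rewrite -[all _ _]negbK -has_predC.
by apply: primrec_negb; apply: primrec_has => //; apply: primrec_negb.
Qed.

Lemma primrec_divn f g :
  primrec f -> primrec g -> primrec (fun v => f v %/ g v).
Proof.
(* The quotient is the last k.+1 whose multiple of [g v] does not exceed [f v]; after m rounds the
   loop holds the minimum of m and the quotient. The factor reflects the convention that division by
   0 gives 0. *)
move=> fP gP; have -> : (fun v => f v %/ g v) = (fun v =>
    ~~ (g v == 0) *
    iteri (f v) (fun k x => if k.+1 * g v <= f v then k.+1 else x) 0).
  apply: funext => v; case: (posnP (g v)) => [->|gv0]; first by rewrite divn0.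
  rewrite mul1n; have H m : iteri m
      (fun k x => if k.+1 * g v <= f v then k.+1 else x) 0 = minn m (f v %/ g v).
    elim: m => [|m IH] /=; first by rewrite min0n.
    rewrite IH -leq_divRL //; case: ifP => [/minn_idPl -> //|/negbT].
    by rewrite -leqNgt => le_m; rewrite !(minn_idPr _) // leqW.
  by rewrite H; apply/esym/minn_idPr; apply: leq_div.
repeat primrec_op; apply: primrec_iteri; repeat primrec_op.
by apply: primrec_if; primrec_under; repeat primrec_op.
Qed.

Lemma primrec_modn f g :
  primrec f -> primrec g -> primrec (fun v => f v %% g v).
Proof.
move=> fP gP; have -> : (fun v => f v %% g v) =
    (fun v => f v - f v %/ g v * g v).
  by apply: funext => v; rewrite {2}(divn_eq (f v) (g v)) addKn.
by repeat primrec_op; apply: primrec_divn.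
Qed.

Lemma primrec_dvdn f g :
  primrec f -> primrec g -> primrec (fun v => g v %| f v : nat).
Proof.
move=> fP gP; apply: (@primrec_eqn (fun v => f v %% g v) (fun=> 0)).
  exact: primrec_modn.
exact: primrec_const.
Qed.

(** * Primitive recursive operations on codes of lists *)

Lemma primrec_code_head f : primrec f -> primrec (fun v => code_head (f v)).
Proof.
(* The same loop for the 2-adic valuation; [f v] rounds are enough because the valuation of a
   positive number is smaller than the number. *)
move=> fP; have -> : (fun v => code_head (f v)) = (fun v =>
    iteri (f v) (fun k x => if 2 ^ k.+1 %| f v then k.+1 else x) 0).
  apply: funext => v; case: (posnP (f v)) => [->//|fv0].
  have H m : iteri m
      (fun k x => if 2 ^ k.+1 %| f v then k.+1 else x) 0 = minn m (logn 2 (f v)).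
    elim: m => [|m IH] /=; first by rewrite min0n.
    rewrite IH pfactor_dvdn //; case: ifP => [/minn_idPl -> //|/negbT].
    by rewrite -leqNgt => le_m; rewrite !(minn_idPr _) // leqW.
  by rewrite H; apply/esym/minn_idPr/ltnW; apply: ltn_logl.
apply: primrec_iteri; repeat primrec_op.
by apply: primrec_if; [apply: primrec_dvdn|..]; primrec_under; repeat primrec_op.
Qed.

Lemma primrec_code_tail f : primrec f -> primrec (fun v => code_tail (f v)).
Proof.
move=> fP; apply: primrec_divn => //.
by repeat primrec_op; apply: primrec_code_head.
Qed.

Lemma primrec_iter_code_tail f g : primrec f -> primrec g ->
  primrec (fun v => iter (f v) code_tail (g v)).
Proof.
move=> fP gP; apply: primrec_iter => //.
by apply: primrec_code_tail; primrec_base.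
Qed.

Lemma primrec_code_nth f g : primrec f -> primrec g ->
  primrec (fun v => code_nth (g v) (f v)).
Proof.
by move=> fP gP; apply: primrec_code_head; apply: primrec_iter_code_tail.
Qed.

Lemma primrec_code_lt f g : primrec f -> primrec g ->
  primrec (fun v => code_lt (f v) (g v) : nat).
Proof.
move=> fP gP; apply: primrec_negb; apply: primrec_eqn; last first.
  exact: primrec_const.
exact: primrec_iter_code_tail.
Qed.

Lemma primrec_code_mem f g : primrec f -> primrec g ->
  primrec (fun v => code_mem (g v) (f v) : nat).
Proof.
move=> fP gP; apply: primrec_has => //.
repeat primrec_op; try apply: primrec_code_lt; try apply: primrec_code_nth.
all: primrec_base.
Qed.

Lemma primrec_code_pair f g : primrec f -> primrec g ->
  primrec (fun v => code_pair (f v) (g v)).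
Proof.
move=> fP gP; under eq_fun do rewrite /code_pair /= muln1 -addn1 -muln2.
by repeat primrec_op.
Qed.

Lemma primrec_code_map n f : primrec n ->
  primrec (fun w => f (behead w) (nth 0 w 0)) ->
  primrec (fun v => CodeSeq.code [seq f v i | i <- iota 0 (n v)]).
Proof.
move=> nP fP.
(* The code of [x :: s] is 2 ^ x * (2 c + 1) with c the code of s, so the code is built from the
   last entry to the first: round k adds entry n - (k + 1). *)
have -> : (fun v => CodeSeq.code [seq f v i | i <- iota 0 (n v)]) =
    (fun v => iteri (n v) (fun k x => 2 ^ f v (n v - k.+1) * (x * 2 + 1)) 0).
  apply: funext => v.
  have H m : m <= n v -> CodeSeq.code [seq f v i | i <- iota (n v - m) m] =
      iteri m (fun k x => 2 ^ f v (n v - k.+1) * (x * 2 + 1)) 0.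
    elim: m => //= m IH lt_m; rewrite -IH; last exact: ltnW.
    by rewrite subnSK // addn1 muln2.
  by rewrite -H // subnn.
apply: primrec_iteri; repeat primrec_op.
have := @primrec_subst2 (fun w => f (behead w) (nth 0 w 0))
  (fun w => n (behead (behead w)) - (nth 0 w 0).+1) fP.
by apply; primrec_under; repeat primrec_op.
Qed.

Lemma primrec_code_filter n (P : seq nat -> nat -> bool) : primrec n ->
  primrec (fun w => P (behead w) (nth 0 w 0) : nat) ->
  primrec (fun v => CodeSeq.code [seq i <- iota 0 (n v) | P v i]).
Proof.
move=> nP PP.
have -> : (fun v => CodeSeq.code [seq i <- iota 0 (n v) | P v i]) =
    (fun v => iteri (n v) (fun k x =>
      if P v (n v - k.+1) then 2 ^ (n v - k.+1) * (x * 2 + 1) else x) 0).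
  apply: funext => v.
  have H m : m <= n v -> CodeSeq.code [seq i <- iota (n v - m) m | P v i] =
      iteri m (fun k x =>
        if P v (n v - k.+1) then 2 ^ (n v - k.+1) * (x * 2 + 1) else x) 0.
    elim: m => //= m IH lt_m; rewrite -IH; last exact: ltnW.
    by case: (P v _); rewrite /= subnSK // addn1 muln2.
  by rewrite -H // subnn.
apply: primrec_iteri; repeat primrec_op.
apply: primrec_if; repeat primrec_op.
have := @primrec_subst2 (fun w => P (behead w) (nth 0 w 0) : nat)
  (fun w => n (behead (behead w)) - (nth 0 w 0).+1) PP.
by apply; primrec_under; repeat primrec_op.
Qed.

(** The factor beside 2 ^ x in the code of [x :: s] is odd, so x is the 2-adic valuation. *)
Lemma code_head_cons x s : code_head (CodeSeq.code (x :: s)) = x.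
Proof.
rewrite /code_head /= lognM ?expn_gt0 // pfactorK // logn_coprime ?addn0 //.
by rewrite coprime2n /= odd_double.
Qed.

Lemma code_tail_code s : code_tail (CodeSeq.code s) = CodeSeq.code (behead s).
Proof.
case: s => [|x s]; first by rewrite /code_tail /= div0n.
rewrite /code_tail code_head_cons /= expnSr divnMA mulKn ?expn_gt0 //.
by rewrite divn2 /= uphalf_double.
Qed.

Lemma iter_code_tail_code i s :
  iter i code_tail (CodeSeq.code s) = CodeSeq.code (drop i s).
Proof.
elim: i => [|i IH]; first by rewrite drop0.
by rewrite iterS IH code_tail_code -drop1 drop_drop add1n.
Qed.

Lemma code_nth_code s i : code_nth (CodeSeq.code s) i = nth 0 s i.
Proof.
rewrite /code_nth iter_code_tail_code; case: (ltnP i (size s)) => [lt_i|le_i].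
  by rewrite (drop_nth 0) // code_head_cons.
by rewrite drop_oversize // nth_default.
Qed.

Lemma code_lt_code s i : code_lt i (CodeSeq.code s) = (i < size s).
Proof.
rewrite /code_lt iter_code_tail_code; case: (ltnP i (size s)) => [lt_i|le_i].
  by rewrite (drop_nth 0) //= muln_eq0 expn_eq0.
by rewrite drop_oversize.
Qed.

(** This bound on positions makes the searches in [code_mem] and [code_accepting] exhaustive. *)
Lemma leq_size_code s : size s <= CodeSeq.code s.
Proof.
elim: s => //= x s IH; rewrite -[_.+1]mul1n; apply: leq_mul.
  by rewrite expn_gt0.
by rewrite ltnS (leq_trans IH) // -addnn leq_addr.
Qed.

Lemma code_mem_code s j : code_mem (CodeSeq.code s) j = (j \in s).
Proof.
apply/hasP/idP => [[i _]|/(nthP 0) [i lt_i <-]].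
  by rewrite code_lt_code code_nth_code => /andP[lt_i /eqP <-]; apply: mem_nth.
exists i; rewrite ?code_lt_code ?code_nth_code ?lt_i ?eqxx //.
by rewrite mem_iota add0n (leq_trans lt_i) // leq_size_code.
Qed.

Lemma code_nth_pair0 x y : code_nth (code_pair x y) 0 = x.
Proof. by rewrite code_nth_code. Qed.

Lemma code_nth_pair1 x y : code_nth (code_pair x y) 1 = y.
Proof. by rewrite code_nth_code. Qed.
(** * Finite monoids and profiles *)

Section Pigeonhole.
Variables (G : monoidType) (N : nat).
Implicit Types x e f : G.
Local Open Scope group_scope.

(** Finiteness of [G] in the form of the pigeonhole principle, as if [G] had at most N elements. *)
Hypothesis collision :
  forall u : nat -> G, exists i j, i < j <= N /\ u i = u j.

(** The powers of x are periodic from some exponent i < N on, with a period j - i <= N. Since N! is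
    a multiple of the period and at least i, adding N! to the exponent N! changes nothing. *)
Lemma expg_fact_idem x : x ^+ N`! * x ^+ N`! = x ^+ N`!.
Proof.
have [i [j [/andP[lt_ij le_jN] eq_ij]]] := collision (fun n => x ^+ n).
have le_iN : i <= N`!.
  by rewrite (leq_trans (ltnW lt_ij)) // (leq_trans le_jN) // fact_geq.
have shift c : x ^+ (i + (j - i) * c) = x ^+ i.
  elim: c => [|c IH]; first by rewrite muln0 addn0.
  by rewrite mulnS addnA subnKC 1?ltnW // expgnDr -eq_ij -expgnDr.
have /dvdnP [c Nc] : (j - i) %| N`!.
  by rewrite dvdn_fact // subn_gt0 lt_ij (leq_trans (leq_subr _ _)).
have eqN : N`! + N`! = i + (j - i) * c + (N`! - i).
  by rewrite mulnC -Nc addnAC subnKC.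
by rewrite -expgnDr eqN expgnDr shift -expgnDr subnKC.
Qed.

(* With a = e a f and b = f b e one has e = a b, hence e = a^n b^n for all n;
   taking a^n idempotent gives a^n = e, and a^n is right-divisible by f. *)
Lemma idem_ideal_eq e f a b : e * e = e -> f * f = f -> e * f = f ->
  f * e = f -> e = e * a * f * b * e -> f = e.
Proof.
move=> ee ff ef fe eab.
pose a' := e * a * f; pose b' := f * b * e; pose M := N`!.-1.
have a'e : a' * e = a' by rewrite /a' -!mulgA fe.
have a'f : a' * f = a' by rewrite /a' -!mulgA ff.
have b'e : b' * e = b' by rewrite /b' -!mulgA ee.
have a'b' : a' * b' = e by rewrite [RHS]eab /a' /b' -!mulgA (mulgA f) ff.
have abn n : a' ^+ n.+1 * b' ^+ n.+1 = e.
  elim: n => [|n IH]; first by rewrite !expg1.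
  rewrite expgSr (expgS b') -mulgA (mulgA a') a'b' (expgS b' n) (mulgA e).
  suff -> : e * b' = b' by rewrite -expgS.
  by rewrite /b' !mulgA ef.
have idem : a' ^+ M.+1 * a' ^+ M.+1 = a' ^+ M.+1.
  by rewrite prednK ?fact_gt0 //; apply: expg_fact_idem.
have eM : a' ^+ M.+1 = e.
  transitivity (a' ^+ M.+1 * e); first by rewrite expgSr -(mulgA _ a' e) a'e.
  by rewrite -[in LHS](abn M) mulgA idem abn.
transitivity (a' ^+ M.+1 * f); first by rewrite eM ef.
by rewrite expgSr -(mulgA _ a' f) a'f -expgSr eM.
Qed.

(** Put f = (e x e)^N!, an idempotent with e f = f e = f. Since z lies in the ideal of f, so does
    its power e, and [idem_ideal_eq] gives f = e. *)
Lemma ideal_power_eq z x (e := z ^+ N`!) :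
  (exists a b, z = a * (e * x * e) ^+ N`! * b) -> (e * x * e) ^+ N`! = e.
Proof.
case=> a [b zab]; set f := (e * x * e) ^+ N`! in zab *.
have ee : e * e = e by apply: expg_fact_idem.
have ff : f * f = f by apply: expg_fact_idem.
have ME : N`! = N`!.-1.+1 by rewrite prednK ?fact_gt0.
have ef : e * f = f by rewrite /f ME expgS !mulgA ee.
have fe : f * e = f by rewrite /f ME expgSr -!mulgA ee.
apply: (@idem_ideal_eq _ _ a (b * z ^+ N`!.-1)) => //.
have ez : e = a * f * (b * z ^+ N`!.-1) by rewrite mulgA -zab -expgS -ME.
transitivity (e * (a * f * (b * z ^+ N`!.-1)) * e); last by rewrite !mulgA.
by rewrite -ez !ee.
Qed.

End Pigeonhole.

Section Profiles.
Variables (Sigma K : finType) (tr : K -> Sigma -> {set K}).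

(* The triple (p, S, q) stands for a path from p to q that visits the states of
   S, the last one excluded. *)
Definition profile : Type := {set K * {set K} * K}.
HB.instance Definition _ := Finite.on profile.

Definition profile_mul (X Y : profile) : profile :=
  [set t : K * {set K} * K | [exists r, exists S1, exists S2,
    [&& (t.1.1, S1, r) \in X, (r, S2, t.2) \in Y & t.1.2 == S1 :|: S2]]]%SET.

Definition profile_one : profile :=
  [set t : K * {set K} * K | (t.1.1 == t.2) && (t.1.2 == finset.set0)]%SET.

Lemma profile_mulP (X Y : profile) p S q : reflect
  (exists r S1 S2, [/\ (p, S1, r) \in X, (r, S2, q) \in Y & S = S1 :|: S2]%SET)
  ((p, S, q) \in profile_mul X Y).
Proof.
rewrite inE; apply: (iffP existsP) => [[r /existsP[S1 /existsP[S2 /and3P[]]]]|].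
  by move=> /= ? ? /eqP ?; exists r, S1, S2.
move=> [r [S1 [S2 [h1 h2 h3]]]]; exists r; apply/existsP; exists S1.
by apply/existsP; exists S2; rewrite h1 h2 h3 eqxx.
Qed.

Lemma profile_mulA : associative profile_mul.
Proof.
move=> X Y Z; apply/setP => -[[p S] q]; apply/profile_mulP/profile_mulP.
  move=> [r [S1 [S2 [h1 /profile_mulP[r' [S3 [S4 [h3 h4 ->]]]] ->]]]].
  exists r', (S1 :|: S3)%SET, S4; rewrite finset.setUA; split=> //.
  by apply/profile_mulP; exists r, S1, S3.
move=> [r [S1 [S2 [/profile_mulP[r' [S3 [S4 [h3 h4 ->]]]] h1 ->]]]].
exists r', S3, (S4 :|: S2)%SET; rewrite finset.setUA; split=> //.
by apply/profile_mulP; exists r, S4, S2.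
Qed.

Lemma profile_oneE p S q :
  ((p, S, q) \in profile_one) = (p == q) && (S == finset.set0).
Proof. by rewrite inE. Qed.

Lemma profile_mul1 : left_id profile_one profile_mul.
Proof.
move=> X; apply/setP => -[[p S] q]; apply/profile_mulP/idP.
  move=> [r [S1 [S2 []]]]; rewrite profile_oneE => /andP[/eqP -> /eqP ->] h ->.
  by rewrite finset.set0U.
move=> h; exists p, finset.set0, S.
by rewrite profile_oneE !eqxx finset.set0U.
Qed.

Lemma profile_mulr1 : right_id profile_one profile_mul.
Proof.
move=> X; apply/setP => -[[p S] q]; apply/profile_mulP/idP.
  move=> [r [S1 [S2 []]]]; rewrite profile_oneE => h /andP[/eqP <- /eqP ->] ->.
  by rewrite finset.setU0.
move=> h; exists q, S, finset.set0.
by rewrite profile_oneE !eqxx finset.setU0.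
Qed.

HB.instance Definition _ :=
  isMonoid.Build profile profile_mulA profile_mul1 profile_mulr1.

Definition letter_profile (a : Sigma) : profile :=
  [set t : K * {set K} * K | (t.1.2 == [set t.1.1]) && (t.2 \in tr t.1.1 a)]%SET.

Local Open Scope group_scope.

Definition word_profile (w : seq Sigma) : profile :=
  foldr (fun a X => letter_profile a * X) 1 w.

Lemma word_profile_cat u v :
  word_profile (u ++ v) = word_profile u * word_profile v.
Proof. by elim: u => [|a u IH] /=; rewrite ?mul1g // IH mulgA. Qed.

Definition segment (sigma : nat -> Sigma) m n : seq Sigma :=
  [seq sigma i | i <- iota m n].

Lemma segmentD sigma m n1 n2 :
  segment sigma m (n1 + n2) = segment sigma m n1 ++ segment sigma (m + n1) n2.
Proof. by rewrite /segment iotaD map_cat. Qed.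

Definition steps (sigma : nat -> Sigma) (r : nat -> K) m n : Prop :=
  forall i, m <= i < n -> r i.+1 \in tr (r i) (sigma i).

Lemma word_profileP sigma m n p S q :
  (p, S, q) \in word_profile (segment sigma m n) <->
  exists r, [/\ r m = p, r (m + n) = q, steps sigma r m (m + n) &
    S = [set s in [seq r i | i <- iota m n]]%SET].
Proof.
elim: n m p S => [|n IH] m p S.
  rewrite /= addn0 profile_oneE; split=> [/andP[/eqP -> /eqP ->]|].
    exists (fun=> q); split=> // i.
    by rewrite ltnNge andbN.
  move=> [r [-> -> _ ->]]; rewrite eqxx /=; apply/eqP/setP => s.
  by rewrite !inE.
rewrite /= addnS; split.
  move=> /profile_mulP[p' [S1 [S2 [+ /IH[r [rm rn rs ->]] ->]]]].
  rewrite inE /= => /andP[/eqP -> p'P].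
  (* The run obtained for the rest of the word is unconstrained at m, so its value there is replaced
     by p. *)
  exists (fun i => if i == m then p else r i); split=> //.
  - by rewrite eqxx.
  - by rewrite -addSn ifN // neq_ltn ltn_addr ?orbT.
  - move=> i /andP[le_mi lt_i].
    case: (eqVneq i m) => [->|ne_im].
      by rewrite ifN ?rm // neq_ltn ltnSn orbT.
    have lt_mi : m < i by rewrite ltn_neqAle eq_sym ne_im.
    rewrite ifN ?neq_ltn ?ltnS ?le_mi ?orbT //; apply: rs.
    by rewrite lt_mi addSn.
  - apply/setP => s; rewrite !inE eqxx; congr (_ || _).
    congr (_ \in _); apply/eq_in_map => i; rewrite mem_iota => /andP[lt_mi _].
    by rewrite ifN // neq_ltn lt_mi orbT.
move=> [r [rm rn rs ->]]; apply/profile_mulP.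
exists (r m.+1), [set p]%SET, [set s in [seq r i | i <- iota m.+1 n]]%SET; split.
- by rewrite inE /= eqxx -rm rs // leqnn ltnS leq_addr.
- apply/IH; exists r; split=> //.
  by move=> i /andP[lt_mi lt_i]; apply: rs; rewrite ltnW //= -addSn.
- by apply/setP => s; rewrite !inE rm.
Qed.

End Profiles.
(** * Acceptance of words in which z recurs *)

(** Pigeonhole: if for every state these positions were bounded, P would fail from the maximum of
    the bounds on. *)
Lemma infinitely_often_fiber (K : finType) (P : nat -> Prop) (r : nat -> K) :
  (forall n, exists2 m, n <= m & P m) ->
  exists q, forall n, exists2 m, n <= m & P m /\ r m = q.
Proof.
move=> infP; apply: contrapT => /forallNP noq.
have bound q : exists n, forall m, n <= m -> P m -> r m <> q.
  have /existsNP[n nP] := noq q; exists n => m le_nm Pm rm; apply: nP.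
  by exists m.
have [f fP] := choice bound.
have [m le_m Pm] := infP (\max_q f q).
exact: (fP (r m) m (leq_trans (leq_bigmax (r m)) le_m) Pm).
Qed.

Lemma inf_statesP (K : finType) (r : nat -> K) q :
  reflect (forall n, exists2 m, n <= m & r m = q) (q \in inf_states r).
Proof. by rewrite inE; apply: asboolP. Qed.

(** Otherwise states outside In(r) would occur at infinitely many positions, so one of them would
    recur and hence belong to In(r). *)
Lemma inf_states_eventually (K : finType) (r : nat -> K) :
  exists n, forall m, n <= m -> r m \in inf_states r.
Proof.
apply: contrapT => /forallNP no_n.
have [|q qP] := @infinitely_often_fiber K (fun m => r m \notin inf_states r) r.
  move=> n; have /existsNP[m /not_implyP[le_nm /negP]] := no_n n.
  by exists m.
have [m _ [+ rm]] := qP 0; rewrite rm => /negP; apply; clear m rm.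
apply/inf_statesP => n.
by have [m ? []] := qP n; exists m.
Qed.

Section GenericWords.
Variables (Sigma K : finType) (tr : K -> Sigma -> {set K}) (q0 : K).
Variables (F : {set {set K}}) (sigma : nat -> Sigma) (z : seq Sigma).

Local Notation prof := (word_profile tr).
Local Notation e := (prof z).
Local Open Scope group_scope.

(** Together with [z_group]: the elements e x e, for x the profile of a word, form a finite group
    with unit e, so each has a power equal to e. *)
Hypothesis z_idem : e * e = e.
Hypothesis z_group : forall w, exists n, (e * prof w * e) ^+ n.+1 = e.

Definition occurs m : Prop := segment sigma m (size z) = z.

Definition good (q : K) : Prop := exists p S0 S,
  [/\ (q, S0, p) \in e, (p, S, p) \in e & S \in F].

Definition reaches m q : Prop :=
  exists r, [/\ r 0 = q0, steps tr sigma r 0 m & r m = q].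

Definition accepting_run (r : nat -> K) : Prop :=
  [/\ r 0 = q0, forall i, r i.+1 \in tr (r i) (sigma i) & inf_states r \in F].

Lemma profile_loop (X : profile K) q S n :
  (q, S, q) \in X -> (q, S, q) \in X ^+ n.+1.
Proof.
move=> qX; elim: n => [|n IH]; first by rewrite expg1.
by rewrite expgS; apply/profile_mulP; exists q, S, S; rewrite finset.setUid.
Qed.

Lemma segment_occurs m d : occurs m -> size z <= d ->
  e * prof (segment sigma m d) = prof (segment sigma m d).
Proof.
by move=> zm le_d; rewrite -(subnKC le_d) segmentD zm word_profile_cat mulgA z_idem.
Qed.

Hypothesis z_recurs : forall n, exists2 m, n <= m & occurs m.

(** Let q recur at occurrences of [z], and let y be the profile of a segment between two of them
    that visits exactly In(r). Then q has a loop for every positive power of y; as e y = y and a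
    power of y e is e, turning such a loop around at the end of its first [z] gives a loop for e. *)
Lemma accepting_run_good r :
  accepting_run r -> exists m q, [/\ reaches m q, good q & occurs m].
Proof.
move=> [r0 rs rF]; set S := inf_states r in rF.
have [n0 n0P] := inf_states_eventually r.
have [q qP] := infinitely_often_fiber r z_recurs.
have [a le_a [za ra]] := qP n0.
have seen s : exists n, s \in S -> exists2 i, a <= i < n & r i = s.
  case: (boolP (s \in S)) => [/inf_statesP sS|_]; last by exists 0.
  by have [i le_i ri] := sS a; exists i.+1 => _; exists i; rewrite ?le_i /=.
have [f fP] := choice seen.
(* The segment from a to b then starts with a whole [z] and meets every state of S. *)
have [b le_b [_ rb]] := qP (maxn (a + size z) (\max_s f s)).
move: le_b; rewrite geq_max => /andP[le_azb le_fb].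
have le_ab : a <= b by rewrite (leq_trans _ le_azb) ?leq_addr.
have ey : e * prof (segment sigma a (b - a)) = prof (segment sigma a (b - a)).
  by apply: segment_occurs; rewrite ?leq_subRL.
set y := prof (segment sigma a (b - a)) in ey.
have qy : (q, S, q) \in y.
  apply/word_profileP; exists r; rewrite subnKC //; split=> //.
  apply/setP => s; rewrite inE; apply/idP/mapP.
    move=> sS; have [i /andP[le_ai lt_i] ri] := fP s sS; exists i => //.
    rewrite mem_iota le_ai subnKC // (leq_trans lt_i) // (leq_trans _ le_fb) //.
    exact: leq_bigmax.
  move=> [i]; rewrite mem_iota => /andP[le_ai _] ->.
  by apply: n0P; apply: leq_trans le_ai.
have [n] := z_group (segment sigma a (b - a)); rewrite -/y ey => ye_n.
have yne k : (y * e) ^+ k.+1 = y ^+ k.+1 * e.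
  elim: k => [|k IH]; first by rewrite !expg1.
  rewrite expgS IH -mulgA (mulgA e) [in e * _]expgS (mulgA e) ey -expgS.
  by rewrite mulgA -expgS.
have ef : e * y ^+ n.+1 = y ^+ n.+1 by rewrite expgS mulgA ey.
have := profile_loop n qy; rewrite -{1}ef.
move=> /profile_mulP[p [S1 [S2 [qe pf eqS]]]].
exists a, q; split=> //; first by exists r; split=> // i _; exact: rs.
exists p, S1, S; split=> //.
rewrite -ye_n yne; apply/profile_mulP; exists q, S2, S1; split=> //.
by rewrite finset.setUC.
Qed.

(** The invariant kept at occurrences of [z]: unlike in [good], already the path to p visits exactly
    S. *)
Definition looping S q : Prop :=
  exists2 p, (q, S, p) \in e & (p, S, p) \in e.

(** With h = e (y e)^n one has y h = e and h y e = e. The loop at p passes through t after y; turned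
    around, it is a loop at t for h y, which starts with e because e h = h. Turned around once more
    at the end t' of this e, it becomes a loop at t' for e. *)
Lemma loop_step (y : profile K) n S p : e * y = y -> (y * e) ^+ n.+1 = e ->
  (p, S, p) \in e ->
  exists t S1, [/\ (p, S1, t) \in y, S1 \subset S & looping S t].
Proof.
move=> ey yen pe; pose h := e * (y * e) ^+ n.
have yh : y * h = e by rewrite /h mulgA -expgS.
have eh : e * h = h by rewrite /h mulgA z_idem.
have := pe; rewrite -{1}yh => /profile_mulP[t [S1 [S2 [py th eqS]]]].
exists t, S1; split=> //; first by rewrite eqS finset.subsetUl.
have : (t, S, t) \in h * y.
  by apply/profile_mulP; exists p, S2, S1; split=> //; rewrite finset.setUC.
rewrite -eh -mulgA => /profile_mulP[t' [S3 [S4 [te tf eqS']]]].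
have t'e : (t', S, t') \in e.
  have -> : e = h * y * e by rewrite /h -!mulgA -expgSr yen z_idem.
  by apply/profile_mulP; exists t, S4, S3; split=> //; rewrite finset.setUC.
(* The path from t to t' is prolonged by the loop at t', which e e = e allows, so that it visits all
   of S. *)
exists t' => //; rewrite -z_idem; apply/profile_mulP; exists t', S3, S; split=> //.
by rewrite eqS' finset.setUA finset.setUid.
Qed.

Lemma run_extend r m m' S t : steps tr sigma r 0 m -> m <= m' ->
  (r m, S, t) \in prof (segment sigma m (m' - m)) ->
  exists r', [/\ forall i, i <= m -> r' i = r i, steps tr sigma r' 0 m',
    r' m' = t & S = [set s in [seq r' i | i <- iota m (m' - m)]]%SET].
Proof.
move=> rs le_mm' /word_profileP[r1]; rewrite subnKC // => -[r1m r1t r1s ->].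
pose r' i := if i <= m then r i else r1 i.
have r'1 i : m <= i -> r' i = r1 i.
  rewrite leq_eqVlt => /predU1P[<-|lt_mi]; rewrite /r' ?leqnn ?r1m //.
  by rewrite leqNgt lt_mi.
exists r'; split; first by move=> i; rewrite /r' => ->.
- move=> i /= lt_i; case: (leqP m i) => [le_mi|lt_im].
    by rewrite !r'1 ?leqW //; apply: r1s; rewrite le_mi.
  by rewrite /r' lt_im ltnW //; apply: rs.
- by rewrite r'1.
- apply/setP => s; rewrite !inE; congr (_ \in _); apply/eq_in_map => i.
  by rewrite mem_iota => /andP[le_mi _]; rewrite r'1.
Qed.

(** The run is built block by block, each block reaching from one occurrence of [z] to a later one
    and visiting exactly S. At the boundaries the state satisfies [looping S], which [loop_step]
    carries over to the next boundary. *)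
Lemma good_accepting_run m q : reaches m q -> good q -> occurs m ->
  exists r, accepting_run r.
Proof.
move=> [r0 [r00 r0s r0m]] [p [S0 [S [qe pe SF]]]] zm.
pose inv (x : (nat -> K) * nat) := [/\ x.1 0 = q0, steps tr sigma x.1 0 x.2,
  looping S (x.1 x.2) & occurs x.2].
(* The premise [inv x] makes the relation total, so that a successor function can be chosen. *)
pose next (x y : (nat -> K) * nat) := inv x -> [/\ inv y, x.2 < y.2,
  forall i, i <= x.2 -> y.1 i = x.1 i &
  S = [set s in [seq y.1 i | i <- iota x.2 (y.2 - x.2)]]%SET].
have block n : occurs n -> exists n' y k,
    [/\ n < n', occurs n', y = prof (segment sigma n (n' - n)),
       e * y = y & (y * e) ^+ k.+1 = e].
  move=> zn; have [n' le_n' zn'] := z_recurs (n + (size z).+1).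
  have lt_n' : n + size z < n' by rewrite -addnS.
  have le_n : n <= n' by rewrite (leq_trans _ (ltnW lt_n')) ?leq_addr.
  have ey := segment_occurs zn (etrans (leq_subRL _ le_n) (ltnW lt_n')).
  have [k] := z_group (segment sigma n (n' - n)); rewrite ey => yk.
  exists n', (prof (segment sigma n (n' - n))), k; split=> //.
  exact: leq_ltn_trans (leq_addr _ _) lt_n'.
have nextP x : exists y, next x y.
  case: (pselect (inv x)) => [[x0 xs [p' xe p'e] zx]|]; last by exists x.
  have [n' [y [k [lt_n' zn' eqy ey yk]]]] := block _ zx.
  have [t [S1 [py sS1 tS]]] := loop_step ey yk p'e.
  (* Since e y = y, the path over the block may begin with the one to p', which visits all of S, and
     continue from p' to t inside S. *)
  have xy : (x.1 x.2, S, t) \in y.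
    rewrite -ey; apply/profile_mulP; exists p', S, S1; split=> //.
    by apply/esym/finset.setUidPl.
  rewrite eqy in xy.
  have [r' [r'x r's r't eqS]] := run_extend xs (ltnW lt_n') xy.
  exists (r', n') => _; split=> //.
  by split; rewrite /= ?r't ?r'x.
(* Up to the end of the first block, which leads from q through p to t, the visited set is not
   controlled; this does not affect In(r). *)
have [x0 x0i] : exists x0, inv x0.
  have [n' [y [k [lt_n' zn' eqy ey yk]]]] := block _ zm.
  have [t [S1 [py sS1 tS]]] := loop_step ey yk pe.
  have qy : (r0 m, S0 :|: S1, t)%SET \in y.
    by rewrite r0m -ey; apply/profile_mulP; exists p, S0, S1.
  rewrite eqy in qy.
  have [r' [r'x r's r't eqS]] := run_extend r0s (ltnW lt_n') qy.
  by exists (r', n'); split; rewrite /= ?r't ?r'x //; case: r00.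
have [nx nxP] := choice nextP; pose u n := iter n nx x0.
have ui n : inv (u n) by elim: n => [//|n /(nxP _)[]].
have lt_u n : (u n).2 < (u n.+1).2 by have [] := nxP _ (ui n).
have le_u i j : i <= j -> (u i).2 <= (u j).2.
  elim: j => [|j IH]; first by rewrite leqn0 => /eqP ->.
  rewrite leq_eqVlt => /predU1P[->//|/IH le_ij].
  exact: leq_trans le_ij (ltnW (lt_u j)).
have ge_u n : n <= (u n).2 by elim: n => // n IH; apply: leq_ltn_trans (lt_u n).
have stable i j k : i <= j -> k <= (u i).2 -> (u j).1 k = (u i).1 k.
  move=> + le_k; elim: j => [|j IH]; first by rewrite leqn0 => /eqP ->.
  rewrite leq_eqVlt => /predU1P[->//|le_ij]; rewrite -IH //.
  have [_ _ -> //] := nxP _ (ui j).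
  by rewrite (leq_trans le_k) // le_u.
(* The finite runs agree on their common prefixes, so the diagonal is their limit. *)
pose r k := (u k).1 k.
have rE i k : k <= (u i).2 -> r k = (u i).1 k.
  move=> le_k; case: (leqP i k) => [le_ik|/ltnW le_ki]; first exact: stable.
  by rewrite /r (stable _ _ _ le_ki).
have block_inf k : (u 0).2 <= k ->
    exists j, k \in iota (u j).2 ((u j.+1).2 - (u j).2).
  (* The block containing k ends at the first boundary beyond k. *)
  move=> le_k; have [] := @ex_minnP (fun j => k < (u j).2).
    by exists k.+1; apply: ge_u.
  case=> [|j] lt_k min_j; first by rewrite ltnNge le_k in lt_k.
  exists j; rewrite mem_iota subnKC ?(ltnW (lt_u _)) // lt_k andbT leqNgt.
  by apply/negP => /min_j; rewrite ltnn.
have uS j : S = [set s in [seq r i | i <- iota (u j).2 ((u j.+1).2 - (u j).2)]]%SET.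
  have [_ _ _ {1}->] := nxP _ (ui j); apply/setP => s; rewrite !inE.
  congr (_ \in _); apply/eq_in_map => i.
  rewrite mem_iota subnKC ?(ltnW (lt_u _)) //.
  by move=> /andP[_ lt_i]; apply: esym; apply: (rE j.+1); apply: ltnW.
exists r; split.
- by rewrite (rE 0) //; case: (ui 0).
- move=> i; rewrite (rE _ _ (ge_u i.+1)) (rE _ _ (ltnW (ge_u i.+1))).
  by have [_ us _ _] := ui i.+1; apply: us; rewrite leq0n ge_u.
- suff -> : inf_states r = S by [].
  apply/setP => s; apply/inf_statesP/idP.
    move=> /(_ (u 0).2)[k le_k <-]; have [j kj] := block_inf k le_k.
    by rewrite (uS j) inE; apply: map_f.
  move=> sS n; move: sS; rewrite (uS n) inE => /mapP[k].
  rewrite mem_iota => /andP[le_k _] ->; exists k => //.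
  exact: leq_trans (ge_u n) le_k.
Qed.

Theorem accepting_run_iff_good :
  (exists r, accepting_run r) <->
  exists m q, [/\ reaches m q, good q & occurs m].
Proof.
split=> [[r /accepting_run_good//]|[m [q []]]]; exact: good_accepting_run.
Qed.

End GenericWords.
(** * The universal word *)

Definition digit (b c i : nat) : nat := c %/ b ^ i %% b.

Lemma ltn_digit b c i : 0 < b -> digit b c i < b.
Proof. exact: ltn_pmod. Qed.

Lemma digitS b c i : digit b c i.+1 = digit b (c %/ b) i.
Proof. by rewrite /digit expnS divnMA. Qed.

(** Horner's scheme, the lowest digit having index 0. *)
Lemma digits_exist b n (f : nat -> nat) : (forall i, i < n -> f i < b) ->
  exists2 c, c < b ^ n & forall i, i < n -> digit b c i = f i.
Proof.
elim: n f => [|n IH] f f_lt; first by exists 0; rewrite ?expn0.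
have [i lt_i|c lt_c cP] := IH (fun i => f i.+1); first exact: f_lt.
have b_gt0 : 0 < b by apply: leq_trans (f_lt 0 _).
exists (c * b + f 0).
  rewrite expnSr (@leq_trans (c.+1 * b)) ?leq_mul2r ?lt_c ?orbT //.
  by rewrite mulSn addnC ltn_add2r f_lt.
case=> [|i] lt_i; first by rewrite /digit divn1 modnMDl modn_small ?f_lt.
by rewrite digitS divnMDl // divn_small ?f_lt // addn0 cP.
Qed.

Lemma digit_add b n c d i : 0 < b -> i < n ->
  digit b (b ^ n * c + d) i = digit b d i.
Proof.
move=> b_gt0 lt_in.
have -> : b ^ n * c = b ^ (n - i.+1) * c * b * b ^ i.
  by rewrite -[RHS]mulnA -expnS mulnAC -expnD subnK.
by rewrite /digit divnMDl ?expn_gt0 ?b_gt0 // modnMDl.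
Qed.

(* Blocks number 0, 1, ..., s ^ N - 1, each listing the N digits of its own
   number in base s, repeated periodically: all words of length N occur. *)
Definition universal_letter (N s t : nat) : nat := digit s (t %/ N) (t %% N).

Definition universal_length (N s : nat) : nat := N * s ^ N * N`!.

Lemma card_set_finType (T : finType) : #|{set T}| = 2 ^ #|T|.
Proof.
by have := card_powerset (finset.setTfor T); rewrite finset.powersetT !cardsT.
Qed.

Lemma card_profile (K : finType) : #|{: profile K}| = 2 ^ (#|K| * 2 ^ #|K| * #|K|).
Proof.
by rewrite (@card_set_finType (K * {set K} * K)%type) !card_prod card_set_finType.
Qed.

Section UniversalWord.
Variables (Sigma K : finType) (tr : K -> Sigma -> {set K}) (a0 : Sigma).

Local Notation prof := (word_profile tr).
Local Notation s := #|Sigma|.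
Local Notation N := #|{: profile K}|.
Let s_gt0 : 0 < s. Proof. by apply/card_gt0P; exists a0. Qed.
Let N_gt0 : 0 < N. Proof. by rewrite card_profile expn_gt0. Qed.

Definition letter (i : nat) : Sigma := nth a0 (enum Sigma) i.

Let lam t : Sigma := letter (universal_letter N s t).

Definition universal_word : seq Sigma := segment lam 0 (universal_length N s).

Let block := segment lam 0 (N * s ^ N).

Lemma power_profile (w : seq Sigma) n :
  prof (flatten (nseq n w)) = (prof w ^+ n)%g.
Proof. by elim: n => // n IH; rewrite /= word_profile_cat IH expgS. Qed.

Lemma profile_collision (X : nat -> profile K) :
  exists i j, i < j <= N /\ X i = X j.
Proof.
have /injectivePn[i [j ne_ij eq_ij]] :
    ~~ injectiveb (fun i : 'I_N.+1 => X i).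
  by apply/injectiveP => /leq_card; rewrite card_ord ltnn.
case: (ltngtP i j) => [lt_ij|lt_ji|/val_inj ij]; last by rewrite ij eqxx in ne_ij.
  by exists i, j; rewrite lt_ij -ltnS ltn_ord.
by exists j, i; rewrite lt_ji -ltnS ltn_ord.
Qed.

(** A word longer than N has two prefixes of equal profile; the letters between their ends can be
    cut out without changing the profile. *)
Lemma short_word (w : seq Sigma) : exists2 w', size w' <= N & prof w' = prof w.
Proof.
have [n] := ubnP (size w); elim: n w => // n IH w; rewrite ltnS => le_w.
case: (leqP (size w) N) => [le_wN|lt_Nw]; first by exists w.
have [i [j [/andP[lt_ij le_jN] eq_ij]]] :=
  profile_collision (fun i => prof (take i w)).
have le_jw : j <= size w := leq_trans le_jN (ltnW lt_Nw).
have [|w' le_w' eq_w'] := IH (take i w ++ drop j w).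
  rewrite size_cat size_drop size_takel ?(leq_trans (ltnW lt_ij)) //.
  rewrite (leq_trans _ le_w) // addnBA // ltn_subLR ?ltn_add2r //.
  by rewrite (leq_trans le_jw) // leq_addl.
exists w' => //; rewrite eq_w' word_profile_cat eq_ij -word_profile_cat.
by rewrite cat_take_drop.
Qed.

(** The shift adds s ^ N * c to the block number, which leaves its N lowest digits unchanged. *)
Lemma universal_letter_shift c t :
  universal_letter N s (N * s ^ N * c + t) = universal_letter N s t.
Proof.
rewrite /universal_letter -mulnA mulnC divnMDl // modnMDl.
by rewrite digit_add // ltn_pmod.
Qed.

Lemma block_shift c : segment lam (N * s ^ N * c) (N * s ^ N) = block.
Proof.
rewrite /block /segment -[in LHS](addn0 (N * s ^ N * c)) iotaDl -map_comp.
by apply: eq_map => t; rewrite /= /lam universal_letter_shift.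
Qed.

Lemma universal_profile : prof universal_word = (prof block ^+ N`!)%g.
Proof.
rewrite /universal_word /universal_length; elim: (N`!) => [|m IH].
  by rewrite muln0.
by rewrite mulnSr segmentD word_profile_cat IH add0n block_shift expgSr.
Qed.

Lemma block_contains (w : seq Sigma) : size w = N ->
  exists u v, block = u ++ w ++ v.
Proof.
move=> size_w.
(* The digits of c are the ranks of the letters of w, so block number c spells w; it lies inside
   [block] because c < s ^ N. *)
have [|c lt_c cP] := @digits_exist s N (fun i => enum_rank (nth a0 w i)).
  by move=> i _; apply: ltn_ord.
exists (segment lam 0 (N * c)), (segment lam (N * c + N) (N * s ^ N - (N * c + N))).
have -> : w = segment lam (N * c) N.
  apply: (@eq_from_nth _ a0) => [|i]; first by rewrite size_map size_iota.
  rewrite size_w => lt_i; rewrite (nth_map 0) ?size_iota // nth_iota //.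
  rewrite /lam /letter /universal_letter mulnC divnMDl // divn_small // addn0.
  by rewrite modnMDl modn_small // cP // nth_enum_rank.
rewrite -[in RHS](add0n (N * c + N)) -!segmentD addnA add0n; congr segment.
by rewrite addnC subnK // addnC -mulnS leq_mul2l lt_c orbT.
Qed.

Lemma universal_word_idem :
  (prof universal_word * prof universal_word = prof universal_word)%g.
Proof.
by rewrite universal_profile; apply: expg_fact_idem; apply: profile_collision.
Qed.

(** By [ideal_power_eq] it is enough that the profile of [block] lies in the ideal of (e x e)^N!.
    That power is the profile of a word, hence of one of length at most N, which after padding with
    [a0] is a factor of [block]. *)
Lemma universal_word_group (w : seq Sigma) : exists n,
  ((prof universal_word * prof w * prof universal_word) ^+ n.+1 =
   prof universal_word)%g.
Proof.
exists N`!.-1; rewrite prednK ?fact_gt0 // universal_profile.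
apply: ideal_power_eq; first exact: profile_collision.
have [w' le_w' eq_w'] := short_word 
    (flatten (nseq N`! (universal_word ++ w ++ universal_word))).
have [|u [v eq_block]] := @block_contains (w' ++ nseq (N - size w') a0).
  by rewrite size_cat size_nseq subnKC.
exists (prof u), (prof (nseq (N - size w') a0) * prof v)%g.
rewrite {1}eq_block !word_profile_cat eq_w' -universal_profile !mulgA.
by rewrite power_profile !word_profile_cat !mulgA.
Qed.

End UniversalWord.
(** * The two automata *)

Section CantorTopology.
Variable Sigma : finType.
Implicit Types (sigma tau : omega_words Sigma) (U : set (omega_words Sigma)).

Definition cylinder sigma m : set (omega_words Sigma) :=
  [set tau | forall i, i < m -> tau i = sigma i].

Lemma coordinate_nbhs sigma i : nbhs sigma [set tau | tau i = sigma i].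
Proof.
have := @proj_continuous nat (fun=> discrete_topology Sigma) i sigma.
by move=> /(_ _ (discrete_set1 (sigma i : discrete_topology Sigma))).
Qed.

Lemma cylinder_nbhs sigma m : nbhs sigma (cylinder sigma m).
Proof.
elim: m => [|m IH]; first by apply: filterS filterT => tau _ i.
apply: filterS (filterI IH (coordinate_nbhs sigma m)) => tau [/= tau_m eq_m] i.
by rewrite ltnS leq_eqVlt => /predU1P[->|/tau_m].
Qed.

Lemma nbhs_cylinder sigma U :
  nbhs sigma U <-> exists m, cylinder sigma m `<=` U.
Proof.
split=> [|[m mU]]; last exact: filterS mU (cylinder_nbhs sigma m).
pose F := filter_from [set: nat] (cylinder sigma).
have FF : Filter F.
  apply: filter_from_filter; first by exists 0.
  move=> i j _ _; exists (maxn i j) => // tau tauP.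
  by split=> k lt_k; apply: tauP; rewrite (leq_trans lt_k) ?leq_maxl ?leq_maxr.
(* Convergence of the filter of cylinders is tested in each coordinate, where the cylinder of length
   i + 1 fixes the value at i. *)
suff : F --> sigma by move=> /[apply] -[m _ mU]; exists m.
apply/cvg_sup => i V [W [[A oA <-] Ai] WV].
exists i.+1 => // tau tauP; apply: WV => /=.
by rewrite tauP.
Qed.

Lemma open_cylinder U :
  (forall sigma, U sigma -> exists m, cylinder sigma m `<=` U) -> open U.
Proof. by move=> UP; rewrite openE => sigma /UP; rewrite -nbhs_cylinder. Qed.

End CantorTopology.
Lemma buchi_acceptP (K : finType) (r : nat -> K) (A : {set K}) :
  (inf_states r :&: A)%SET != finset.set0 <->
  forall n, exists2 m, n <= m & r m \in A.
Proof.
split=> [/set0Pn[q] | infA].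
  rewrite inE => /andP[/inf_statesP qr qA] n.
  by have [m le_nm rm] := qr n; exists m => //; rewrite rm.
have [q qP] := infinitely_often_fiber r infA.
apply/set0Pn; exists q; rewrite inE; apply/andP; split.
  by apply/inf_statesP => n; have [m le_nm [_ rm]] := qP n; exists m.
by have [m _ [rA rm]] := qP 0; rewrite -rm.
Qed.

Section OrdinalBuchi.
Variables (Sigma : finType) (n : nat) (i0 : 'I_n).
Variables (next : nat -> nat -> nat -> bool) (acc : nat -> bool).

(** On ordinals [enum_rank] is the identity and letters enter only through their rank, so the data
    of the automaton can be computed from [next] and [acc]. *)
Definition ord_buchi : buchi Sigma :=
  @Buchi Sigma (@Fsm Sigma 'I_n
    (fun q a => [set q' : 'I_n | next q (enum_rank a) q']%SET) i0)
    [set q : 'I_n | acc q]%SET.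

Lemma ord_buchi_langP (sigma : omega_words Sigma) :
  buchi_lang ord_buchi sigma <-> exists r : nat -> nat,
  [/\ r 0 = i0, forall i, r i < n,
      forall i, next (r i) (enum_rank (sigma i : Sigma)) (r i.+1) &
      forall m, exists2 i, m <= i & acc (r i)].
Proof.
split=> [[r [r0 rs] /buchi_acceptP rF]|[r [r0 rn rs rF]]].
  exists (fun i => r i : 'I_n); split=> //; first by rewrite r0.
    by move=> i; have := rs i; rewrite inE.
  by move=> m; have [i le_mi] := rF m; rewrite inE; exists i.
exists (fun i => Ordinal (rn i)).
  by split=> [|i]; [apply: val_inj | rewrite inE; apply: rs].
by apply/buchi_acceptP => m; have [i le_mi ri] := rF m; exists i; rewrite ?inE.
Qed.

End OrdinalBuchi.

(* States below k copy the given machine; state k + t has read t + 1 letters of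
   the word lam 0, ..., lam (l - 1). *)
Definition read_next (k l : nat) (d : nat -> nat -> nat -> bool)
    (gd : nat -> bool) (lam : nat -> nat) (i a j : nat) : bool :=
  [|| [&& i < k, j < k & d i a j], [&& i < k, j == k, gd i & a == lam 0],
      [&& k <= i, j == i.+1 & a == lam (i - k).+1]
    | [&& k <= i, i.+1 == k + l & j == i]].

(* After an initial wait in state 0, the input is cut into blocks of length l.
   State t + 1 is position t of a block, state l + t + 1 is position t of a block
   in which a letter different from lam has been seen. *)
Definition avoid_next (l : nat) (lam : nat -> nat) (i a j : nat) : bool :=
  [|| (i == 0) && ((j == 0) || (j == 1)),
      [&& 0 < i, i <= l & ((i < l) && (j == i.+1)) ||
        ((a != lam i.-1) &&
          (((i < l) && (j == l + i.+1)) || ((i == l) && (j == 1))))]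
    | (l < i) && (((i < l + l) && (j == i.+1)) || ((i == l + l) && (j == 1)))].

(** * Runs of the reading and of the avoiding automaton *)

Section ReadLang.
Variables (k l : nat) (d : nat -> nat -> nat -> bool) (gd : nat -> bool).
Variables (lam : nat -> nat) (w : nat -> nat) (i0 : nat).
Hypotheses (l_gt0 : 0 < l) (i0_lt : i0 < k).

Lemma read_runP :
  (exists r : nat -> nat,
    [/\ r 0 = i0, forall i, r i < k + l,
        forall i, read_next k l d gd lam (r i) (w i) (r i.+1) &
        forall m, exists2 i, m <= i & (r i).+1 == k + l]) <->
  exists m (r : nat -> nat),
    [/\ r 0 = i0, forall i, i <= m -> r i < k,
        forall i, i < m -> d (r i) (w i) (r i.+1), gd (r m) &
        forall t, t < l -> w (m + t) = lam t].
Proof.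
split=> [[r [r0 r_lt rs rF]]|[m [r [r0 r_lt rs rm wm]]]].
  (* At the first time outside the copy, one letter of the word has been read; the time before it is
     the required m. *)
  have [] := @ex_minnP (fun i => k <= r i).
    have [i _ /eqP ri] := rF 0; exists i; rewrite -ltnS ri.
    by rewrite -[X in X < _]addn0 ltn_add2l.
  case=> [|m]; first by rewrite r0 leqNgt i0_lt.
  move=> le_krm min_m.
  have r_ltk i : i <= m -> r i < k.
    by move=> le_im; rewrite ltnNge; apply/negP => /min_m; rewrite ltnNge le_im.
  have := rs m; rewrite /read_next (leqNgt k (r m)) (leqNgt k) in le_krm *.
  rewrite r_ltk // (negPf le_krm) /= orbF => /and3P[/eqP rk gm /eqP w0].
  exists m, r; split=> //.
    move=> i lt_im; have := rs i.
    have [ri ri1] := (r_ltk i (ltnW lt_im), r_ltk i.+1 lt_im).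
    by rewrite /read_next (leqNgt k) ri ri1 /= (ltn_eqF ri1) /= orbF.
  have H t : t < l -> w (m + t) = lam t /\ r (m + t).+1 = k + t.
    elim: t => [|t IH] lt_tl; first by rewrite !addn0.
    have [_ rt] := IH (ltnW lt_tl); have := rs (m + t).+1.
    rewrite /read_next rt ltnNge leq_addr /= addKn -(addnS k t).
    rewrite eqn_add2l (ltn_eqF lt_tl) /= orbF => /andP[/eqP eq_r /eqP eq_w].
    by rewrite (addnS m).
  by move=> t /H[].
(* At time m + 1 + c the run is in state k + c; the minimum keeps it in the accepting state k + l -
   1 once the word is read. *)
exists (fun i => if i <= m then r i else minn (k + (i - m.+1)) (k + l.-1)).
have kl : (k + l.-1).+1 = k + l by rewrite -addnS prednK.
split=> //.
- move=> i; case: (leqP i m) => [/r_lt r_i|_].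
    by rewrite (leq_trans r_i) // leq_addr.
  by rewrite -kl ltnS geq_minr.
- move=> i; rewrite /read_next; case: (ltngtP i m) => [lt_im|lt_mi|->].
  + by rewrite !r_lt // ?rs // ltnW.
  + have [c ->] : exists c, i = m.+1 + c by exists (i - m.+1); rewrite subnKC.
    rewrite /= -(addnS m.+1) !addKn.
    case: (ltnP c.+1 l) => [lt_cl|le_lc].
      have le_c : c < l.-1 by rewrite -ltnS prednK.
      rewrite !(minn_idPl _) ?leq_add2l // ?(ltnW le_c) //.
      by rewrite ltnNge leq_addr /= addKn addSnnS wm // eqxx addnS eqxx.
    have le_c : l.-1 <= c by rewrite -ltnS prednK.
    rewrite !(minn_idPr _) ?leq_add2l ?(leqW le_c) //.
    by rewrite kl leq_addr !eqxx !orbT.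
  + rewrite r_lt // subnn addn0 rm (minn_idPl _) ?leq_addr // eqxx.
    by rewrite -[m in w m]addn0 wm // eqxx orbT.
- move=> N; exists (maxn N (m.+1 + l)); first exact: leq_maxl.
  rewrite ifN; last by rewrite -ltnNge leq_max ltnS leq_addr orbT.
  rewrite (minn_idPr _) ?kl //.
  rewrite leq_add2l leq_subRL; last by rewrite leq_max leq_addr orbT.
  by rewrite leq_max leq_add2l leq_pred orbT.
Qed.
End ReadLang.

Section AvoidLang.
Variables (l : nat) (lam w : nat -> nat).
Hypothesis l_gt0 : 0 < l.

(** A block cannot be crossed without a mismatch: the upper copy is entered only at a letter
    different from [lam], and the end of the lower copy is left only by such a letter. *)
Lemma avoid_block (r : nat -> nat) m :
  (forall i, avoid_next l lam (r i) (w i) (r i.+1)) -> r m = 1 ->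
  r (m + l) = 1 /\ exists2 u, u < l & w (m + u) != lam u.
Proof.
move=> rs rm.
have H t : t < l -> r (m + t) = t.+1 \/
    r (m + t) = l + t.+1 /\ exists2 u, u < t & w (m + u) != lam u.
  elim: t => [|t IH] lt_tl; first by left; rewrite addn0.
  have := rs (m + t); rewrite -addnS.
  have [->|[-> [u lt_ut wu]]] := IH (ltnW lt_tl); rewrite /avoid_next /=.
    rewrite lt_tl (ltnW lt_tl) ltnNge (ltnW lt_tl) (ltn_eqF lt_tl) /= !orbF.
    case/orP=> [/eqP ->|/andP[wt /eqP ->]]; first by left.
    by right; split=> //; exists t.
  rewrite addnS /= (leqNgt _ l) ltnS leq_addr /= -addnS ltn_add2l lt_tl.
  rewrite eqn_add2l (ltn_eqF lt_tl) /= orbF => /eqP ->; right.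
  by rewrite !addnS; split=> //; exists u => //; apply: leqW.
have := rs (m + l.-1); rewrite -addnS prednK //.
have := H l.-1; rewrite prednK // => /(_ (leqnn l)).
case=> [->|[-> [u lt_ul wu]]]; rewrite /avoid_next /=.
  rewrite l_gt0 leqnn ltnn eqxx (gtn_eqF l_gt0) /= orbF.
  by move=> /andP[wl /eqP]; split=> //; exists l.-1; rewrite ?prednK.
rewrite addn_eq0 (gtn_eqF l_gt0) addn_gt0 l_gt0 /= leqNgt -[X in X < _]addn0.
rewrite ltn_add2l l_gt0 /= ltnn eqxx /= => /eqP; split=> //.
by exists u => //; rewrite (leq_trans lt_ul) // leq_pred.
Qed.

Lemma avoid_runP :
  (exists r : nat -> nat,
    [/\ r 0 = 0, forall i, r i < (l + l).+1,
        forall i, avoid_next l lam (r i) (w i) (r i.+1) &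
        forall m, exists2 i, m <= i & r i != 0]) <->
  exists n, forall j, exists2 u, u < l & w (n + j * l + u) != lam u.
Proof.
split=> [[r [r0 r_lt rs rF]]|[n nP]].
  have [] := @ex_minnP (fun i => r i != 0); first by have [i _] := rF 0; exists i.
  case=> [|m]; first by rewrite r0.
  move=> rm1 min_m; have rm : r m = 0.
    by apply/eqP/negPn/negP => /min_m; rewrite ltnn.
  have rn : r m.+1 = 1.
    have := rs m; rewrite /avoid_next rm /= orbF => /orP[|/eqP //].
    by rewrite (negPf rm1).
  exists m.+1 => j; have [] // := @avoid_block r (m.+1 + j * l) rs.
  elim: j => [|j IH]; first by rewrite addn0.
  by have [+ _] := avoid_block rs IH; rewrite mulSnr addnA.
(* One block is skipped so that the initial wait in state 0 is not empty. *)
pose n' := n + l.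
have n'E j : n' + j * l = n + j.+1 * l by rewrite /n' -addnA -mulSn.
have [f fP] := choice (fun j => let: ex_intro2 u lt_u wu := nP j in
  ex_intro (fun u => u < l /\ w (n + j * l + u) != lam u) u (conj lt_u wu)).
(* Positions up to the chosen mismatch use the lower copy, later ones the upper. The block number is
   shifted by one because [f] counts blocks from n and [st] from n'. *)
pose st i := let t := (i - n') %% l in
  if t <= f ((i - n') %/ l).+1 then t.+1 else l + t.+1.
have stE j t : t < l -> st (n' + j * l + t) =
    if t <= f j.+1 then t.+1 else l + t.+1.
  move=> lt_tl; rewrite /st -addnA addKn modnMDl divnMDl // modn_small //.
  by rewrite divn_small // addn0.
exists (fun i => if i < n' then 0 else st i); split.
- by rewrite addn_gt0 l_gt0 orbT.
- move=> i; case: ifP => // _; rewrite /st.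
  have := ltn_pmod (i - n') l_gt0; set t := _ %% l => lt_tl.
  by case: ifP => _; rewrite ltnS ?leq_add2l // (leq_trans lt_tl) ?leq_addr.
- move=> i; case: (ltngtP i.+1 n') => [lt_i|lt_i|eq_i].
  + by [].
  + have [j [t [lt_tl ->]]] : exists j t, t < l /\ i = n' + j * l + t.
      exists ((i - n') %/ l), ((i - n') %% l); split; first exact: ltn_pmod.
      by rewrite -addnA -divn_eq subnKC // -ltnS.
    have [fl fw] := fP j.+1; rewrite -n'E in fw; rewrite stE //.
    case: (ltnP t.+1 l) => [lt_tl1|le_lt].
      rewrite -addnS stE //; case: (ltngtP t (f j.+1)) => [lt_f|lt_f|eq_f].
      * by rewrite /avoid_next /= lt_tl1 (ltnW lt_tl1) eqxx.
      * rewrite /avoid_next addn_eq0 (gtn_eqF l_gt0) ltn_addr //= leqNgt.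
        by rewrite -[X in X < _]addn0 ltn_add2l /= ltn_add2l lt_tl1 addnS eqxx.
      * rewrite /avoid_next /= lt_tl1 (ltnW lt_tl1) eq_f fw eqxx.
        by rewrite !orbT.
    have eq_t : t.+1 = l by apply/eqP; rewrite eqn_leq le_lt lt_tl.
    have -> : (n' + j * l + t).+1 = n' + j.+1 * l + 0.
      by rewrite -addnS eq_t -addnA -mulSnr addn0.
    rewrite stE //= eq_t; case: ifP => [le_f|_].
      have eq_f : t = f j.+1.
        by apply/eqP; rewrite eqn_leq le_f -ltnS eq_t fl.
      have l_pred : l.-1 = t by rewrite -eq_t.
      rewrite -eq_f in fw.
      by rewrite /avoid_next l_gt0 leqnn ltnn eqxx l_pred fw /= eqxx /= orbT.
    rewrite /avoid_next addn_eq0 (gtn_eqF l_gt0) addn_gt0 l_gt0 /= leqNgt.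
    by rewrite -[X in X < _]addn0 ltn_add2l l_gt0 ltnn !eqxx.
  + rewrite /= eq_i -[X in st X]addn0.
    by rewrite -[X in st (X + 0)]addn0 -(mul0n l) stE.
- move=> m; exists (maxn m n'); first exact: leq_maxl.
  rewrite ltnNge leq_maxr /= /st; case: ifP => // _.
  by rewrite addnS.
Qed.

End AvoidLang.
(** A path over two copies of the word is guessed as a single number c, whose L + L + 1 digits in
    base k are its states. The second half must be a loop, and [ac] judges the indicator function of
    the states visited there. *)
Definition good_state (k L : nat) (d : nat -> nat -> nat -> bool)
    (lam : nat -> nat) (ac : (nat -> bool) -> bool) (q : nat) : bool :=
  has (fun c => [&& digit k c 0 == q, digit k c L == digit k c (L + L),
    all (fun t => d (digit k c t) (lam t) (digit k c t.+1)) (iota 0 (L + L)) &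
    ac (fun i => has (fun t => digit k c (L + t) == i) (iota 0 L))])
  (iota 0 (k ^ (L + L).+1)).

Lemma enum_rank_nth (T : finType) (x0 : T) i : i < #|T| ->
  enum_rank (nth x0 (enum T) i) = i :> nat.
Proof.
move=> lt_i; have -> : nth x0 (enum T) i = enum_val (Ordinal lt_i).
  by rewrite (enum_val_nth x0).
by rewrite enum_valK.
Qed.

Lemma iota_shift m n : iota m n = [seq m + i | i <- iota 0 n].
Proof. by rewrite -iotaDl addn0. Qed.

(** * Languages of the two automata and their topology *)

Section Construction.
Variables (Sigma : finType) (M : fsm Sigma) (F : {set {set state M}}).
Variables (d : nat -> nat -> nat -> bool) (ac : (nat -> bool) -> bool).
Variable a0 : Sigma.

Local Notation rank := (fun q => nat_of_ord (enum_rank q)).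
Local Notation k := #|state M|.
Local Notation s := #|Sigma|.
Local Notation N := (2 ^ (k * 2 ^ k * k)).
Local Notation L := (universal_length N s).
Local Notation lam := (universal_letter N s).
Local Notation tr := (@trans Sigma M).

Hypothesis dP : forall p a q,
  d (enum_rank p) (enum_rank a) (enum_rank q) = (q \in tr p a).
Hypothesis acP : forall (V : {set state M}) vis,
  (forall q, vis (enum_rank q : nat) = (q \in V)) -> ac vis = (V \in F).

Let zl t : Sigma := letter a0 (lam t).
Let z := segment zl 0 L.

Lemma s_gt0 : 0 < s. Proof. by apply/card_gt0P; exists a0. Qed.

Lemma k_gt0 : 0 < k. Proof. by apply/card_gt0P; exists (init M). Qed.

Lemma N_gt0 : 0 < N. Proof. by rewrite expn_gt0. Qed.

Lemma L_gt0 : 0 < L.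
Proof. by rewrite !muln_gt0 N_gt0 expn_gt0 s_gt0 fact_gt0. Qed.

Lemma rank_zl t : rank (zl t) = lam t.
Proof. by apply: enum_rank_nth; apply: ltn_digit; apply: s_gt0. Qed.

Lemma size_z : size z = L.
Proof. by rewrite size_map size_iota. Qed.

Lemma z_universal : z = universal_word (state M) a0.
Proof. by rewrite /universal_word /z /zl -card_profile. Qed.

(** L is a multiple of the period of [zl], so a path along the first L + L letters of [zl] reads [z]
    twice. *)
Lemma segment_zl_shift : segment zl L L = z.
Proof.
rewrite /z /segment (iota_shift L) -map_comp.
apply: eq_map => t /=; rewrite /zl; congr letter.
rewrite -(card_profile (state M)) /universal_length.
exact: universal_letter_shift.
Qed.

Lemma occursP (sigma : nat -> Sigma) m :
  occurs sigma z m <-> forall t, t < L -> rank (sigma (m + t)) = lam t.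
Proof.
rewrite /occurs size_z; split=> [eqz t lt_t|eqz].
  have := congr1 (fun u => nth a0 u t) eqz.
  rewrite !(nth_map 0) ?size_iota // !nth_iota // add0n => ->.
  exact: rank_zl.
apply: (@eq_from_nth _ a0) => [|t]; rewrite !size_map ?size_iota // => lt_t.
rewrite !(nth_map 0) ?size_iota // !nth_iota // add0n.
by apply: enum_rank_inj; apply: val_inj; rewrite /= eqz // rank_zl.
Qed.

Let st (i : nat) : state M := nth (init M) (enum (state M)) i.

Lemma rank_st i : i < k -> rank (st i) = i.
Proof. exact: enum_rank_nth. Qed.

Lemma st_rank q : st (rank q) = q.
Proof. exact: nth_enum_rank. Qed.

Lemma good_stateP q :
  good_state k L d lam ac (rank q) <-> good tr F z q.
Proof.
have vis_iota (r : nat -> nat) p : (forall t, r t < k) ->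
    has (fun t => r (L + t) == rank p) (iota 0 L) =
    (p \in [set x in [seq st (r i) | i <- iota L L]]%SET).
  move=> r_lt; rewrite inE (iota_shift L) -map_comp.
  apply/hasP/mapP => [[t tL /eqP rt]|[t tL ->]]; exists t => //=.
    by rewrite rt st_rank.
  by rewrite rank_st.
split.
  move=> /hasP[c _ /and4P[/eqP c0 /eqP cL /allP c_step c_ac]].
  have c_lt t : digit k c t < k by apply: ltn_digit; apply: k_gt0.
  pose r t := st (digit k c t).
  have r_step : steps tr zl r 0 (L + L).
    move=> t /= lt_t; rewrite -dP !rank_st // rank_zl; apply: c_step.
    by rewrite mem_iota.
  exists (r L), [set x in [seq r i | i <- iota 0 L]]%SET.
  exists [set x in [seq r i | i <- iota L L]]%SET; split.
  - apply/word_profileP; exists r; split=> //; first by rewrite /r c0 st_rank.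
    by move=> t /= lt_t; apply: r_step; rewrite ltn_addr.
  - rewrite -segment_zl_shift; apply/word_profileP; exists r; split=> //.
      by rewrite /r cL.
    by move=> t /andP[_ lt_t]; apply: r_step.
  - have visP p := vis_iota (digit k c) p c_lt.
    by move: c_ac; rewrite (acP visP).
move=> [p [S0 [S [/word_profileP[r1 [r10 r1L r1s _]]]]]].
rewrite -segment_zl_shift => /word_profileP[r2 [r2L r2LL r2s ->]] SF.
(* Both paths are in state p at L, so they join into one path whose states become the digits of
   c. *)
pose r t := if t < L then r1 t else r2 t.
have rE1 t : t <= L -> r t = r1 t.
  rewrite leq_eqVlt /r => /predU1P[->|->] //.
  by rewrite ltnn r2L -r1L.
have rE2 t : L <= t -> r t = r2 t by rewrite /r ltnNge => ->.
have [c lt_c cP] := @digits_exist k (L + L).+1 (fun t => rank (r t))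
  (fun i _ => ltn_ord _).
apply/hasP; exists c; first by rewrite mem_iota.
have cE t : t <= L + L -> digit k c t = rank (r t) by move=> ?; apply: cP.
apply/and4P; split.
- by rewrite cE // rE1 // r10.
- by rewrite !cE ?leq_addr // !rE2 ?leq_addr // r2L r2LL.
- apply/allP => t; rewrite mem_iota => /= lt_t.
  rewrite !cE // ?(ltnW lt_t) // -rank_zl dP.
  case: (ltnP t L) => [lt_tL|le_Lt].
    by rewrite !rE1 // ?(ltnW lt_tL) //; apply: r1s.
  by rewrite !rE2 // ?leqW //; apply: r2s; rewrite le_Lt.
- have visS x : has (fun t => digit k c (L + t) == rank x) (iota 0 L) =
      (x \in [set y in [seq r2 i | i <- iota L L]]%SET).
    rewrite inE (iota_shift L) -map_comp.
    apply/hasP/mapP => [[t]|[t]]; rewrite mem_iota => /= lt_t.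
      rewrite cE ?leq_add2l ?(ltnW lt_t) // => /eqP/val_inj/enum_rank_inj <-.
      by exists t; rewrite ?mem_iota // rE2 ?leq_addr.
    move=> ->; exists t; first by rewrite mem_iota.
    by rewrite cE ?leq_add2l ?(ltnW lt_t) // rE2 ?leq_addr.
  by rewrite (acP visS).
Qed.

Lemma init_ltn : rank (init M) < k + L.
Proof. by rewrite ltn_addr. Qed.

Definition open_part : buchi Sigma :=
  ord_buchi Sigma (Ordinal init_ltn)
    (read_next k L d (good_state k L d lam ac) lam) (fun i => i.+1 == k + L).

Definition meager_part : buchi Sigma :=
  @ord_buchi Sigma (L + L).+1 ord0 (avoid_next L lam) (fun i => i != 0).

Lemma open_part_langP (sigma : omega_words Sigma) :
  buchi_lang open_part sigma <-> exists m q,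
    [/\ reaches tr (init M) sigma m q, good tr F z q & occurs sigma z m].
Proof.
apply: iff_trans (ord_buchi_langP _ _ _ _) _.
apply: iff_trans (read_runP _ _ _ (fun i => rank (sigma i)) L_gt0 _) _.
  exact: (ltn_ord (enum_rank (init M))).
split=> [[m [r [r0 r_lt rs rm zm]]]|[m [q [[r [r0 rs rm]] gq /occursP zm]]]].
  exists m, (st (r m)); split.
  - exists (fun i => st (r i)); split=> //; first by rewrite r0 st_rank.
    move=> i /= lt_i; rewrite -dP !rank_st ?r_lt ?(ltnW lt_i) //.
    exact: rs.
  - by apply/good_stateP; rewrite rank_st ?r_lt.
  - exact/occursP.
exists m, (fun i => rank (r i)); split=> //.
- by rewrite r0.
- by move=> i lt_i; rewrite dP; apply: rs.
- by rewrite rm; apply/good_stateP.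
Qed.

Lemma open_part_open : open (buchi_lang open_part).
Proof.
apply: open_cylinder => sigma /open_part_langP[m [q [[r [r0 rs rm]] gq zm]]].
(* Reaching q at time m and reading [z] from there concern only the first m + L letters. *)
exists (m + L) => tau tauP; apply/open_part_langP; exists m, q; split=> //.
  exists r; split=> // i /= lt_i; rewrite tauP; first exact: rs.
  by rewrite ltn_addr.
apply/occursP => t lt_t; rewrite tauP ?ltn_add2l //.
exact: (iffLR (occursP _ _) zm).
Qed.

Definition avoiding n : set (omega_words Sigma) := [set sigma |
  forall j, exists2 u, u < L & rank (sigma (n + j * L + u)) != lam u].

Lemma meager_part_langP : buchi_lang meager_part = \bigcup_n avoiding n.
Proof.
apply/seteqP; split=> sigma.
  move=> /ord_buchi_langP /(avoid_runP _ _ L_gt0)[n nP].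
  by exists n.
move=> [n _ nP]; apply/ord_buchi_langP.
by apply/(avoid_runP _ _ L_gt0); exists n.
Qed.

Lemma avoiding_closed n : closed (avoiding n).
Proof.
rewrite -[avoiding n]setCK closedC; apply: open_cylinder => sigma.
move=> /existsNP[j jP]; exists (n + j * L + L) => tau tauP /(_ j)[u lt_u].
by rewrite tauP ?ltn_add2l // => ne_u; apply: jP; exists u.
Qed.

Lemma avoiding_interior n : (avoiding n)° = set0.
Proof.
apply/seteqP; split=> // sigma /nbhs_cylinder[m mP].
(* After the given prefix come copies of [z] in step with the blocks counted from n. Block number m
   starts at n + m * L, hence not before m, and equals [z]. *)
pose tau i := if i < m then sigma i else zl ((i - n) %% L).
have /mP /(_ m)[u lt_u] : cylinder sigma m tau by move=> i; rewrite /tau => ->.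
have le_m : m <= n + m * L + u.
  rewrite -addnA (leq_trans _ (leq_addl _ _)) //.
  by rewrite (leq_trans _ (leq_addr _ _)) // leq_pmulr ?L_gt0.
rewrite /tau ltnNge le_m /= -addnA addKn modnMDl modn_small // rank_zl.
by rewrite eqxx.
Qed.

Lemma sym_diff_sub (sigma : omega_words Sigma) :
  ~ buchi_lang meager_part sigma ->
  (exists r, accepting_run tr (init M) F sigma r) <->
  buchi_lang open_part sigma.
Proof.
move=> notC; apply: iff_trans (iff_sym (open_part_langP sigma)).
rewrite z_universal; apply: accepting_run_iff_good.
- exact: universal_word_idem.
- exact: universal_word_group.
(* If [z] occurred nowhere from n on, no block counted from n would be [z], and the word would lie
   in [avoiding n]. *)
rewrite -z_universal => n; apply: contrapT => no_m; apply: notC.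
rewrite meager_part_langP; exists n => // j; apply: contrapT => no_u.
apply: no_m; exists (n + j * L); first exact: leq_addr.
apply/occursP => t lt_t; apply/eqP/negPn/negP => ne_t; apply: no_u.
by exists t.
Qed.

End Construction.
(** * Computation of their codes *)

Definition encode_buchi (n s i0 : nat) (next : nat -> nat -> nat -> bool)
    (acc : nat -> bool) : nat :=
  code_pair
    (code_pair (code_pair (code_pair n s) i0)
      (CodeSeq.code [seq CodeSeq.code [seq
        CodeSeq.code [seq j <- iota 0 n | next i a j]
        | a <- iota 0 s] | i <- iota 0 n]))
    (CodeSeq.code [seq j <- iota 0 n | acc j]).

Definition code_fsm (x : nat) : nat := code_nth (code_nth x 1) 0.
Definition code_acc (x : nat) : nat := code_nth (code_nth x 1) 1.
Definition code_states (x : nat) : nat :=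
  code_nth (code_nth (code_nth (code_fsm x) 0) 0) 0.
Definition code_letters (x : nat) : nat :=
  code_nth (code_nth (code_nth (code_fsm x) 0) 0) 1.
Definition code_init (x : nat) : nat := code_nth (code_nth (code_fsm x) 0) 1.
Definition code_trans (x p a q : nat) : bool :=
  code_mem (code_nth (code_nth (code_nth (code_fsm x) 1) p) a) q.
(** Entry 0 of the input is the tag: 0 for Buechi, where the visited set must meet the accepting
    set, otherwise Muller, where it must equal a listed set. *)
Definition code_accepting (x : nat) (vis : nat -> bool) : bool :=
  (code_nth x 0 == 0) &&
    has (fun i => code_mem (code_acc x) i && vis i) (iota 0 (code_states x)) ||
  (code_nth x 0 != 0) &&
    has (fun j => code_lt j (code_acc x) &&
      all (fun i => code_mem (code_nth (code_acc x) j) i == vis i)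
        (iota 0 (code_states x))) (iota 0 (code_acc x)).

(** The number of profiles over the states of the input machine, by [card_profile]. *)
Definition code_period (x : nat) : nat :=
  2 ^ (code_states x * 2 ^ code_states x * code_states x).
Definition code_length (x : nat) : nat :=
  universal_length (code_period x) (code_letters x).
Definition code_letter (x t : nat) : nat :=
  universal_letter (code_period x) (code_letters x) t.
Definition code_good (x q : nat) : bool :=
  good_state (code_states x) (code_length x) (code_trans x) (code_letter x)
    (code_accepting x) q.
Definition code_read (x : nat) : nat -> nat -> nat -> bool :=
  read_next (code_states x) (code_length x) (code_trans x) (code_good x)
    (code_letter x).
Definition code_avoid (x : nat) : nat -> nat -> nat -> bool :=
  avoid_next (code_length x) (code_letter x).

Definition construct (x : nat) : nat :=
  code_pair
    (encode_buchi (code_states x + code_length x) (code_letters x) (code_init x)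
      (code_read x) (fun i => i.+1 == code_states x + code_length x))
    (encode_buchi (code_length x + code_length x).+1 (code_letters x) 0
      (code_avoid x) (fun i => i != 0)).

Lemma pickle_pair (T1 T2 : countType) (p : T1 * T2) :
  pickle p = code_pair (pickle p.1) (pickle p.2).
Proof. by []. Qed.

Lemma pickle_seqE (T : countType) (u : seq T) :
  pickle u = CodeSeq.code [seq pickle x | x <- u].
Proof. by []. Qed.

Lemma pickle_seq_nat (u : seq nat) : pickle u = CodeSeq.code u.
Proof. by rewrite pickle_seqE map_id. Qed.

Lemma set_dataP (K : finType) (S : {set K}) q :
  (nat_of_ord (enum_rank q) \in set_data S) = (q \in S).
Proof.
apply/mapP/idP => [[p + /val_inj/enum_rank_inj ->]|qS]; first by rewrite mem_enum.
by exists q => //; rewrite mem_enum.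
Qed.

Lemma set_data_ord n (P : nat -> bool) :
  set_data [set j : 'I_n | P j]%SET = [seq j <- iota 0 n | P j].
Proof.
rewrite /set_data.
have -> : enum [set j : 'I_n | P j]%SET = [seq j <- enum 'I_n | P (val j)].
  by rewrite enumT; apply: eq_filter => j; rewrite !inE.
rewrite -val_enum_ord filter_map.
by apply: eq_map => j; rewrite enum_rank_ord.
Qed.

Lemma map_enum_rank (T : finType) R (f : nat -> R) :
  [seq f (enum_rank x) | x <- enum T] = [seq f i | i <- iota 0 #|T|].
Proof.
rewrite (map_comp f (fun x => nat_of_ord (enum_rank x))); congr map.
apply: (@eq_from_nth _ 0) => [|i]; rewrite size_map ?size_iota -cardE // => lt_i.
rewrite (nth_map (enum_val (Ordinal lt_i))) -?cardE // nth_iota //.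
exact: enum_rank_nth.
Qed.

Lemma pickle_buchi_data (Sigma : finType) n (i0 : 'I_n) next acc :
  pickle (buchi_data (ord_buchi Sigma i0 next acc)) =
  encode_buchi n #|Sigma| i0 next acc.
Proof.
rewrite /buchi_data pickle_pair /fsm_data 3!pickle_pair /=.
rewrite !pickle_seq_nat set_data_ord /encode_buchi; congr code_pair.
congr code_pair; first by rewrite enum_rank_ord /= card_ord.
rewrite pickle_seqE -map_comp -val_enum_ord -map_comp; congr CodeSeq.code.
apply: eq_map => i; rewrite /= pickle_seqE -map_comp -map_enum_rank.
congr CodeSeq.code; apply: eq_map => a.
by rewrite /= pickle_seq_nat set_data_ord val_enum_ord.
Qed.

Definition machine (Sigma : finType) (A : buchi Sigma + muller Sigma) :
    fsm Sigma :=
  match A with inl B => buchi_fsm B | inr M => muller_fsm M end.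

(** Buechi acceptance becomes the Muller condition given by all sets that meet the accepting set, so
    both cases are treated at once. *)
Definition acceptance (Sigma : finType) (A : buchi Sigma + muller Sigma) :
    {set {set state (machine A)}} :=
  match A with
  | inl B => [set S | (S :&: buchi_acc B)%SET != finset.set0]%SET
  | inr M => muller_acc M
  end.

Definition acceptance_code (Sigma : finType) (A : buchi Sigma + muller Sigma) :
    nat :=
  match A with
  | inl B => CodeSeq.code (set_data (buchi_acc B))
  | inr M => CodeSeq.code
      [seq CodeSeq.code (set_data X) | X <- enum (muller_acc M)]
  end.

Lemma langE (Sigma : finType) (A : buchi Sigma + muller Sigma)
    (sigma : omega_words Sigma) :
  lang A sigma <-> exists r,
    accepting_run (@trans Sigma (machine A)) (init (machine A)) (acceptance A)
      sigma r.
Proof.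
case: A => [B|M]; split=> [[r [r0 rs] rF]|[r [r0 rs rF]]].
- by exists r; split=> //; rewrite inE.
- by exists r; [split|rewrite inE in rF].
- by exists r.
- by exists r; [split|].
Qed.

Section InputCode.
Variables (Sigma : finType) (A : buchi Sigma + muller Sigma).
Local Notation M := (machine A).
Local Notation x := (input_code A).

Lemma input_codeE :
  x = code_pair (if A is inl _ then 0 else 1) (code_pair (pickle (fsm_data M))
    (acceptance_code A)).
Proof.
case: A => [B|N]; rewrite /input_code pickle_pair /=.
  by rewrite /buchi_data pickle_pair /= pickle_seq_nat.
rewrite /muller_data pickle_pair /= pickle_seqE -map_comp.
by under eq_map do rewrite /= pickle_seq_nat.
Qed.

Lemma code_fsmE : code_fsm x = code_pair (code_pair (code_pair #|state M| #|Sigma|)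
  (enum_rank (init M))) (pickle (fsm_data M).2).
Proof. by rewrite /code_fsm input_codeE code_nth_pair1 code_nth_pair0. Qed.

Lemma code_statesE : code_states x = #|state M|.
Proof. by rewrite /code_states code_fsmE !code_nth_pair0. Qed.

Lemma code_lettersE : code_letters x = #|Sigma|.
Proof. by rewrite /code_letters code_fsmE !code_nth_pair0 code_nth_pair1. Qed.

Lemma code_initE : code_init x = enum_rank (init M).
Proof. by rewrite /code_init code_fsmE code_nth_pair0 code_nth_pair1. Qed.

Lemma code_accE : code_acc x = acceptance_code A.
Proof. by rewrite /code_acc input_codeE !code_nth_pair1. Qed.

Lemma code_transP (p : state M) (a : Sigma) (q : state M) :
  code_trans x (enum_rank p) (enum_rank a) (enum_rank q) = (q \in trans p a).
Proof.
rewrite /code_trans code_fsmE code_nth_pair1 pickle_seqE code_nth_code.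
rewrite -map_comp (nth_map p) -?cardE ?ltn_ord // nth_enum_rank /=.
rewrite pickle_seqE code_nth_code -map_comp (nth_map a) -?cardE ?ltn_ord //.
by rewrite nth_enum_rank /= pickle_seq_nat code_mem_code set_dataP.
Qed.

Lemma code_acceptingP (V : {set state M}) vis :
  (forall q, vis (enum_rank q : nat) = (q \in V)) ->
  code_accepting x vis = (V \in acceptance A).
Proof.
move=> visP; rewrite /code_accepting code_accE code_statesE input_codeE.
rewrite code_nth_pair0; case: A V visP => [B|N] V visP /=; rewrite ?orbF.
  rewrite inE; apply/hasP/set0Pn => [[i]|[q]].
    rewrite mem_iota code_mem_code => /= lt_i /andP[].
    move=> /mapP[q + eq_i]; rewrite mem_enum {}eq_i visP => qB qV.
    by exists q; rewrite inE qV.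
  rewrite inE => /andP[qV qB]; exists (enum_rank q : nat).
    by rewrite mem_iota ltn_ord.
  by rewrite code_mem_code set_dataP qB visP.
have nthE j : j < size (enum (muller_acc N)) -> forall i, code_mem (code_nth
    (CodeSeq.code [seq CodeSeq.code (set_data X) | X <- enum (muller_acc N)]) j) i =
    (i \in set_data (nth finset.set0 (enum (muller_acc N)) j)).
  move=> lt_j i; rewrite code_nth_code (nth_map finset.set0) //.
  exact: code_mem_code.
apply/hasP/idP => [[j _]|VF].
  rewrite code_lt_code size_map => /andP[lt_j /allP allV].
  suff <- : nth finset.set0 (enum (muller_acc N)) j = V.
    by rewrite -mem_enum mem_nth.
  apply/setP => q; rewrite -visP -set_dataP -nthE //; apply/eqP/allV.
  by rewrite mem_iota ltn_ord.
have jV : index V (enum (muller_acc N)) < size (enum (muller_acc N)).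
  by rewrite index_mem mem_enum.
exists (index V (enum (muller_acc N))).
  rewrite mem_iota add0n (leq_trans jV) //.
  by rewrite -(size_map (fun X => CodeSeq.code (set_data X))) leq_size_code.
rewrite code_lt_code size_map jV; apply/allP => i; rewrite mem_iota => /= lt_i.
rewrite nthE // nth_index ?mem_enum //.
by rewrite -[i]/(val (Ordinal lt_i)) -(enum_valK (Ordinal lt_i)) visP set_dataP.
Qed.

End InputCode.

(** * Primitive recursiveness of the construction *)

Ltac primrec_strip H :=
  first
  [ exact: H
  | exact: (primrec_behead H)
  | exact: (primrec_behead (primrec_behead H))
  | exact: (primrec_behead (primrec_behead (primrec_behead H)))
  | exact: (primrec_behead (primrec_behead (primrec_behead (primrec_behead H))))
  | exact: (primrec_behead (primrec_behead (primrec_behead (primrec_behead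
      (primrec_behead H))))) ].

Ltac primrec_named := cbv beta;
  lazymatch goal with
  | |- primrec (fun w => nth 0 (behead _) _) =>
      under eq_fun do rewrite !nth_behead; exact: primrec_nth
  | H : primrec ?f |- primrec (fun w => ?f (behead _)) => primrec_strip H
  | |- primrec (fun v => @?f v %/ @?g v) => apply: (@primrec_divn f g)
  | |- primrec (fun v => @?f v %% @?g v) => apply: (@primrec_modn f g)
  | |- primrec (fun v => code_nth (@?f v) (@?g v)) =>
      apply: (@primrec_code_nth g f)
  | |- primrec (fun v => nat_of_bool (code_lt (@?f v) (@?g v))) =>
      apply: (@primrec_code_lt f g)
  | |- primrec (fun v => nat_of_bool (code_mem (@?f v) (@?g v))) =>
      apply: (@primrec_code_mem g f)
  | |- primrec (fun v => code_pair (@?f v) (@?g v)) =>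
      apply: (@primrec_code_pair f g)
  | |- primrec (fun v => nat_of_bool (has (@?P v) (iota 0 (@?n v)))) =>
      apply: (@primrec_has n P)
  | |- primrec (fun v => nat_of_bool (all (@?P v) (iota 0 (@?n v)))) =>
      apply: (@primrec_all n P)
  | |- _ => primrec_op
  end.

Section PrimrecNamed.
Variables f g h k : seq nat -> nat.
Hypotheses (fP : primrec f) (gP : primrec g) (hP : primrec h) (kP : primrec k).

Lemma primrec_digit : primrec (fun v => digit (f v) (g v) (h v)).
Proof. by rewrite /digit; repeat primrec_named. Qed.

Lemma primrec_code_acc : primrec (fun v => code_acc (f v)).
Proof. by rewrite /code_acc; repeat primrec_named. Qed.

Lemma primrec_code_states : primrec (fun v => code_states (f v)).
Proof. by rewrite /code_states /code_fsm; repeat primrec_named. Qed.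

Lemma primrec_code_letters : primrec (fun v => code_letters (f v)).
Proof. by rewrite /code_letters /code_fsm; repeat primrec_named. Qed.

Lemma primrec_code_init : primrec (fun v => code_init (f v)).
Proof. by rewrite /code_init /code_fsm; repeat primrec_named. Qed.

Lemma primrec_code_trans :
  primrec (fun v => code_trans (f v) (g v) (h v) (k v) : nat).
Proof. by rewrite /code_trans /code_fsm; repeat primrec_named. Qed.

End PrimrecNamed.

Lemma primrec_code_period f : primrec f -> primrec (fun v => code_period (f v)).
Proof.
move=> /primrec_code_states kP; rewrite /code_period.
by repeat primrec_named.
Qed.

Lemma primrec_code_length f : primrec f -> primrec (fun v => code_length (f v)).
Proof.
move=> fP; have NP := primrec_code_period fP; have sP := primrec_code_letters fP.
by rewrite /code_length /universal_length; repeat primrec_named.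
Qed.

Lemma primrec_code_letter f g : primrec f -> primrec g ->
  primrec (fun v => code_letter (f v) (g v)).
Proof.
move=> fP gP; have NP := primrec_code_period fP.
have sP := primrec_code_letters fP; rewrite /code_letter /universal_letter.
by apply: primrec_digit; repeat primrec_named.
Qed.

Ltac primrec_code := cbv beta;
  lazymatch goal with
  | |- primrec (fun v => digit (@?f v) (@?g v) (@?h v)) =>
      apply: (@primrec_digit f g h)
  | |- primrec (fun v => code_acc (@?f v)) => apply: (@primrec_code_acc f)
  | |- primrec (fun v => code_states (@?f v)) => apply: (@primrec_code_states f)
  | |- primrec (fun v => code_letters (@?f v)) =>
      apply: (@primrec_code_letters f)
  | |- primrec (fun v => code_init (@?f v)) => apply: (@primrec_code_init f)
  | |- primrec (fun v => code_length (@?f v)) => apply: (@primrec_code_length f)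
  | |- primrec (fun v => code_letter (@?f v) (@?g v)) =>
      apply: (@primrec_code_letter f g)
  | |- primrec (fun v =>
        nat_of_bool (code_trans (@?f v) (@?g v) (@?h v) (@?k v))) =>
      apply: (@primrec_code_trans f g h k)
  | |- _ => primrec_named
  end.

Lemma primrec_code_good f g : primrec f -> primrec g ->
  primrec (fun v => code_good (f v) (g v) : nat).
Proof.
move=> fP gP; rewrite /code_good /good_state /code_accepting.
by repeat primrec_code.
Qed.

Lemma primrec_code_read f i a j :
  primrec f -> primrec i -> primrec a -> primrec j ->
  primrec (fun v => code_read (f v) (i v) (a v) (j v) : nat).
Proof.
move=> fP iP aP jP; rewrite /code_read /read_next.
have gP := primrec_code_good fP iP.
by repeat primrec_code.
Qed.

Lemma primrec_code_avoid f i a j :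
  primrec f -> primrec i -> primrec a -> primrec j ->
  primrec (fun v => code_avoid (f v) (i v) (a v) (j v) : nat).
Proof.
move=> fP iP aP jP; rewrite /code_avoid /avoid_next.
by repeat primrec_code; exact: primrec_pred.
Qed.

(** The innermost bound variable comes first in the list: entries 0, 1 and 2 are the target state,
    the letter and the source state. *)
Lemma primrec_encode_buchi (n s i0 : seq nat -> nat)
    (next : seq nat -> nat -> nat -> nat -> bool) (acc : seq nat -> nat -> bool) :
  primrec n -> primrec s -> primrec i0 ->
  primrec (fun w => next (behead (behead (behead w))) (nth 0 w 2) (nth 0 w 1)
    (nth 0 w 0) : nat) ->
  primrec (fun w => acc (behead w) (nth 0 w 0) : nat) ->
  primrec (fun v => encode_buchi (n v) (s v) (i0 v) (next v) (acc v)).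
Proof.
move=> nP sP i0P nextP accP; rewrite /encode_buchi.
apply: primrec_code_pair; last exact: primrec_code_filter.
apply: primrec_code_pair; first by repeat primrec_named.
apply: primrec_code_map => //; apply: primrec_code_map; first exact: primrec_behead.
apply: primrec_code_filter; first exact: primrec_behead (primrec_behead nP).
by under eq_fun do rewrite !nth_behead.
Qed.

Lemma construct_computable : computable construct.
Proof.
apply: primrec_computable; rewrite /construct.
have xP : primrec (fun v => nth 0 v 0) by exact: primrec_nth.
apply: primrec_code_pair; apply: primrec_encode_buchi; repeat primrec_code.
- by apply: primrec_code_read; repeat primrec_code.
- by apply: primrec_code_avoid; repeat primrec_code.
Qed.

Theorem theorem10 :
  exists2 construct : nat -> nat, computable construct &
    forall (Sigma : finType) (A : buchi Sigma + muller Sigma),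
      1 < #|Sigma| ->
      exists B C : buchi Sigma,
        [/\ construct (input_code A) = output_code B C,
            open (buchi_lang B),
            (exists2 E : nat -> set (omega_words Sigma),
               (forall n, closed (E n) /\ (E n)° = set0) &
               buchi_lang C = \bigcup_n E n) &
            lang A `+` buchi_lang B `<=` buchi_lang C].
Proof.
exists construct; first exact: construct_computable.
move=> Sigma A lt1; have [a0 _] : exists a0 : Sigma, true.
  by have /card_gt0P[a0 _] := ltnW lt1; exists a0.
pose M := machine A; pose x := input_code A.
pose B := @open_part Sigma M (code_trans x) (code_accepting x).
pose C := @meager_part Sigma M.
exists B, C; split.
(* Both sides are [encode_buchi] of the same predicates once the numbers of states and letters and
   the initial state have been decoded from the input. *)
- rewrite /output_code pickle_pair /= !pickle_buchi_data /=.
  rewrite /construct /code_read /code_avoid /code_good /code_letter /code_length.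
  by rewrite /code_period code_statesE code_lettersE code_initE.
- by apply: (open_part_open a0); [exact: code_transP | exact: code_acceptingP].
- exists (avoiding M) => [n|]; last exact: meager_part_langP.
  by split; [exact: avoiding_closed | exact: avoiding_interior].
(* Outside the language of C, membership in the other two languages is equivalent, which excludes
   the symmetric difference. *)
- move=> sigma AB; apply: contrapT => notC.
  have AE : lang A sigma <-> buchi_lang B sigma.
    apply: iff_trans (langE A sigma) _; apply: (sym_diff_sub a0) notC.
      exact: code_transP.
    exact: code_acceptingP.
  by case: AB => -[] /AE.
Qed.
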